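(* Given any affine algebraic variety $V$ (over $K$), there exists a path algebra modulo relations, $\Lambda=K\Gamma/I$, satisfying condition (N), together with a sequence $\mathbb S$ of simple left $\Lambda$-modules such that $V_{\mathbb S}\cong V$. Moreover, $\mathbb S$ can be chosen so that the canonical map $$\Phi_{\mathbb S}:V_{\mathbb S}\longrightarrow\{\text{isomorphism types of uniserial left }\Lambda\text{-modules with composition series }\mathbb S\}$$ is bijective.
   Context: **Setting.** $K$ is an infinite field. Algebras are of the form $\Lambda=K\Gamma/I$ with $\Gamma$ a finite quiver and $I$ an admissible ideal of the path algebra $K\Gamma$; $J$ is the Jacobson radical of $\Lambda$. Vertices of $\Gamma$ are identified with the corresponding primitive idempotents of $\Lambda$. Paths are composed so that $qp$ means ''$q$ after $p$''; vertices are the paths of length $0$. A right subpath of a path $p$ is a path $u$ with $p=u'u$ in $K\Gamma$ for some path $u'$ (lengths $0$ allowed). Modules are finitely generated left modules. Affine varieties over $K$ are Zariski closed subsets of some $K^n$, not necessarily irreducible. **Uniserial modules, masts.** A module is uniserial if its submodules form a chain. A uniserial module $U$ of composition length $l+1$ has composition series $\mathbb S=(S(0),\dots,S(l))$ if $J^iU/J^{i+1}U\cong S(i)$ for all $i$. A mast of $U$ is a path $p$ in $K\Gamma$ of length $l$ with $pU\neq 0$; a path is called a mast if it is a mast of some uniserial left $\Lambda$-module. A top element of $U$ is an element $x\in U\setminus JU$ with $x=ex$ for a vertex $e$. **Condition (N).** Whenever $\alpha:e\to e'$ is an arrow in $\Gamma$ and $p:e\to e'$ is a mast of positive length, then $p\in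 K\Gamma\alpha\cup\alpha K\Gamma$ (i.e. $p$ starts or ends with the arrow $\alpha$). Condition (N) implies that $\Gamma$ has no two distinct arrows with the same start and the same end. **Detours, $V_p$, $V_{\mathbb S}$, $\Phi_{\mathbb S}$.** Let $p$ be a path. A detour on $p$ is a pair $(\alpha,u)$ with $u$ a right subpath of $p$ and $\alpha$ an arrow such that $\alpha u$ is a path which is not a right subpath of $p$, but there is a right subpath of $p$ strictly longer than $u$ ending in the same vertex as $\alpha$. All right subpaths of $p$ that are longer than $u$ and end in the same vertex as $\alpha$ are denoted $v_i(\alpha,u)$, $i\in I(\alpha,u)$. Let $D$ be the set of triples $(\alpha,u,i)$ with $(\alpha,u)$ a detour on $p$ and $i\in I(\alpha,u)$. $V_p\subseteq K^D$ is the set of all points $k=(k_i(\alpha,u))$ for which there are a uniserial left $\Lambda$-module $U$ with mast $p$ and a top element $x$ of $U$ with $\alpha ux=\sum_{i\in I(\alpha,u)}k_i(\alpha,u)v_i(\alpha,u)x$ for all detours $(\alpha,u)$ on $p$; this set is known to be Zariski closed, and such a $U$ is determined by $k$ up to isomorphism. Suppose (N) holds. For a sequence $\mathbb S=(S(0),\dots,S(l))$ of simple modules, with corresponding vertices $e(0),\dots,e(l)$, there is at most one path $p$ of length $l$ through $e(0),\dots,e(l)$ in this order; set $V_{\mathbb S}=V_p$ (empty if no such path exists). $\Phi_{\mathbb S}$ sends $k\in V_{\mathbb S}$ to the isomorphism class of the module $U$ determined by $k$. *)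

(* Defs.v *)
From HB Require Import structures.
From mathcomp Require Import all_boot all_order all_algebra.
From mathcomp Require Import finmap.
From mathcomp.multinomials Require Import mpoly.
From mathcomp Require Import boolp classical_sets functions cardinality.

Set Implicit Arguments.
Unset Strict Implicit.
Unset Printing Implicit Defensive.

Import GRing.Theory.
Local Open Scope ring_scope.
Local Open Scope quotient_scope.
Local Open Scope classical_set_scope.

(* The ambient space K^T is indexed by an arbitrary finite type T; polynomials
   on it are polynomials in #|T| variables, through the enumeration of T. *)

Section Varieties.
Variable K : fieldType.

Definition peval (T : finType) (P : {mpoly K[#|T|]}) (x : {ffun T -> K}) : K :=
  P.@[fun i => x (enum_val i)].

Definition zariski_closed (T : finType) (V : set {ffun T -> K}) : Prop :=
  exists S : set {mpoly K[#|T|]}, V = [set x | forall P, S P -> peval P x = 0].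

Definition polynomial_map (T T' : finType) (f : {ffun T -> K} -> {ffun T' -> K}) :
  Prop := exists F : T' -> {mpoly K[#|T|]}, forall x t, f x t = peval (F t) x.

(* Morphisms of (embedded) affine varieties are the restrictions of polynomial
   maps between the ambient spaces. *)
Definition variety_iso (T T' : finType)
    (V : set {ffun T -> K}) (W : set {ffun T' -> K}) : Prop :=
  exists (f : {ffun T -> K} -> {ffun T' -> K})
         (g : {ffun T' -> K} -> {ffun T -> K}),
  [/\ polynomial_map f, polynomial_map g,
      forall x, V x -> W (f x) /\ g (f x) = x &
      forall y, W y -> V (g y) /\ f (g y) = y].

End Varieties.

(* Submodules are the library's [submodClosed U]; since [asbool] turns every
   proposition into a boolean, these are all the submodules of [U]. *)

Section Submodules.
Variables (R : pzRingType) (U : lmodType R).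
Implicit Types N M : submodClosed U.

Definition full_pred : {pred U} := fun _ => true.
Lemma full_pred_closed : submod_closed full_pred. Proof. by []. Qed.
HB.instance Definition _ := GRing.isSubmodClosed.Build R U full_pred
  full_pred_closed.
Definition fullm : submodClosed U := full_pred.

Definition zero_pred : {pred U} := fun x => x == 0.
Lemma zero_pred_closed : submod_closed zero_pred.
Proof.
split=> [|a x y]; rewrite !unfold_in /zero_pred ?eqxx // => /eqP-> /eqP->.
by rewrite scaler0 addr0.
Qed.
HB.instance Definition _ := GRing.isSubmodClosed.Build R U zero_pred
  zero_pred_closed.
Definition zerom : submodClosed U := zero_pred.

Definition span_pred (X : set U) : {pred U} :=
  fun x => `[< forall N, X `<=` [set y | y \in N] -> x \in N >].
Lemma span_pred_closed X : submod_closed (span_pred X).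
Proof.
split=> [|a x y]; rewrite !unfold_in.
  by apply/asboolP => N _; exact: rpred0.
move=> /asboolP Nx /asboolP Ny; apply/asboolP => N XN.
by apply: rpredD; [apply: rpredZ; exact: Nx | exact: Ny].
Qed.
HB.instance Definition _ X := GRing.isSubmodClosed.Build R U (span_pred X)
  (span_pred_closed X).
Definition span (X : set U) : submodClosed U := span_pred X.

Definition smulm (A : set R) N : submodClosed U :=
  span [set z | exists a x, [/\ A a, x \in N & z = a *: x]].

Fixpoint powm (A : set R) (i : nat) : submodClosed U :=
  if i is i'.+1 then smulm A (powm A i') else fullm.

Definition submod N : Type := {x : U | x \in N}.
HB.instance Definition _ N := SubChoice.on (submod N).
Lemma submodP N : submod_closed N.
Proof.
split=> [|a x y Nx Ny]; first exact: rpred0.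
by apply: rpredD => //; exact: rpredZ.
Qed.
HB.instance Definition _ N :=
  GRing.SubChoice_isSubLmodule.Build R U (fun x => x \in N) (submod N)
    (submodP N).

Definition as_zmod N : {pred U} := fun x => x \in N.
Lemma as_zmod_closed N : zmod_closed (as_zmod N).
Proof. by have /GRing.submod_closedB := submodP N. Qed.
HB.instance Definition _ N := GRing.isZmodClosed.Build U (as_zmod N)
  (as_zmod_closed N).

Definition quotmod N : Type := Quotient.quot (as_zmod N).
Section Quotmod.
Variable N : submodClosed U.
HB.instance Definition _ := GRing.Zmodule.on (quotmod N).
HB.instance Definition _ := ZmodQuotient.on (quotmod N).

Definition quotmod_scale (a : R) : quotmod N -> quotmod N :=
  lift_op1 (quotmod N) ( *:%R a).

Lemma pi_quotmod_scale a (x : U) :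
  \pi_(quotmod N) (a *: x) = quotmod_scale a (\pi_(quotmod N) x).
Proof.
rewrite /quotmod_scale; unlock; apply/eqP.
rewrite -Quotient.idealrBE -scalerBr; apply: (@rpredZ _ _ N).
by have := Quotient.idealrBE (as_zmod N) x (repr (\pi_(quotmod N) x));
  rewrite reprK eqxx.
Qed.

Lemma quotmod_scalerA a b (v : quotmod N) :
  quotmod_scale a (quotmod_scale b v) = quotmod_scale (a * b) v.
Proof. by rewrite -[v]reprK -!pi_quotmod_scale scalerA. Qed.
Lemma quotmod_scale1r : left_id 1 quotmod_scale.
Proof. by move=> v; rewrite -[v]reprK -pi_quotmod_scale scale1r. Qed.
Lemma quotmod_scalerDr : right_distributive quotmod_scale +%R.
Proof.
move=> a v w; rewrite -[v]reprK -[w]reprK -raddfD -!pi_quotmod_scale.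
by rewrite scalerDr raddfD.
Qed.
Lemma quotmod_scalerDl v : {morph quotmod_scale^~ v : a b / a + b}.
Proof.
by move=> a b; rewrite -[v]reprK -!pi_quotmod_scale scalerDl raddfD.
Qed.
HB.instance Definition _ := GRing.Zmodule_isLmodule.Build R (quotmod N)
  quotmod_scalerA quotmod_scale1r quotmod_scalerDr quotmod_scalerDl.
End Quotmod.

End Submodules.

Arguments fullm {R} U.
Arguments zerom {R} U.
Arguments powm {R} U A i.

Section Subquotients.
Variables (R : pzRingType) (U : lmodType R) (N M : submodClosed U).

Definition trace_pred : {pred submod N} := fun x => val x \in M.
Lemma trace_pred_closed : submod_closed trace_pred.
Proof.
split=> [|a x y Mx My]; rewrite unfold_in /trace_pred ?linear0 ?rpred0 //.
by rewrite linearP; apply: rpredD => //; exact: rpredZ.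
Qed.
HB.instance Definition _ := GRing.isSubmodClosed.Build R (submod N) trace_pred
  trace_pred_closed.

(* N / (N :&: M); it is used only with M included in N, where it is N / M. *)
Definition subquot : lmodType R := quotmod (trace_pred : submodClosed _).
End Subquotients.

Section ModuleNotions.
Variable R : pzRingType.
Implicit Types U V : lmodType R.

Definition module_iso U V : Prop := exists f : {linear U -> V}, bijective f.

Definition finitely_generated U : Prop :=
  exists s : seq U, span [set` s] =i fullm U.

Definition simple_module U : Prop :=
  ~ (zerom U =i fullm U) /\
  forall N : submodClosed U, N =i zerom U \/ N =i fullm U.

Definition uniserial U : Prop :=
  finitely_generated U /\
  forall N M : submodClosed U, {subset N <= M} \/ {subset M <= N}.

Definition has_length U (n : nat) : Prop :=
  exists M : nat -> submodClosed U,
  [/\ M 0 =i zerom U, M n =i fullm U &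
      forall i, (i < n)%N -> {subset M i <= M i.+1} /\
                             simple_module (subquot (M i.+1) (M i))].

Definition maximal_left_ideal (N : submodClosed R^o) : Prop :=
  ~ (N =i fullm R^o) /\
  forall M : submodClosed R^o, {subset N <= M} -> M =i N \/ M =i fullm R^o.

Definition jacobson_radical : set R :=
  [set a | forall N, maximal_left_ideal N -> (a : R^o) \in N].

Definition radm U (i : nat) : submodClosed U := powm U jacobson_radical i.

Definition has_series U l (S : 'I_l.+1 -> lmodType R) : Prop :=
  [/\ uniserial U, has_length U l.+1 &
      forall i : 'I_l.+1, module_iso (subquot (radm U i) (radm U i.+1)) (S i)].

Definition iso_class U : lmodType R -> Prop := fun V => module_iso V U.

End ModuleNotions.

HB.mixin Record isTwoSided (R : pzRingType) (I : {pred R}) := {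
  idealMl : forall a x, x \in I -> a * x \in I;
  idealMr : forall a x, x \in I -> x * a \in I }.

#[short(type="twoSidedIdeal")]
HB.structure Definition TwoSidedIdeal (R : pzRingType) :=
  {I of GRing.ZmodClosed R I & isTwoSided R I}.

Section IdealSpan.
Variables (R : pzRingType) (X : set R).
Definition ideal_span_pred : {pred R} :=
  fun x => `[< forall I : twoSidedIdeal R, X `<=` [set y | y \in I] -> x \in I >].
Lemma ideal_span_zmod : zmod_closed ideal_span_pred.
Proof.
split=> [|x y]; rewrite !unfold_in.
  by apply/asboolP => I _; exact: rpred0.
move=> /asboolP Ix /asboolP Iy; apply/asboolP => I XI.
by apply: rpredB; [exact: Ix | exact: Iy].
Qed.
HB.instance Definition _ := GRing.isZmodClosed.Build R ideal_span_pred
  ideal_span_zmod.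
Lemma ideal_spanMl a x : x \in ideal_span_pred -> a * x \in ideal_span_pred.
Proof.
move=> /asboolP Ix; apply/asboolP => I XI; apply: idealMl; exact: Ix.
Qed.
Lemma ideal_spanMr a x : x \in ideal_span_pred -> x * a \in ideal_span_pred.
Proof.
move=> /asboolP Ix; apply/asboolP => I XI; apply: idealMr; exact: Ix.
Qed.
HB.instance Definition _ := isTwoSided.Build R ideal_span_pred
  ideal_spanMl ideal_spanMr.
Definition ideal_span : twoSidedIdeal R := ideal_span_pred.
End IdealSpan.

Record quiver := Quiver {
  vertex : finType;
  arrow : finType;
  src : arrow -> vertex;
  tgt : arrow -> vertex }.
Arguments src {q} a.
Arguments tgt {q} a.

Section Paths.
Variable Q : quiver.

Fixpoint chain (e : vertex Q) (s : seq (arrow Q)) : bool :=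
  if s is a :: s' then (src a == e) && chain (tgt a) s' else true.

(* The arrows are listed in the order in which they are traversed: the path
   written a_l ... a_1 (first a_1, last a_l) has [parrows] = [:: a_1; ...; a_l].
   The starting vertex is recorded so as to have a path of length 0 for every
   vertex. *)
Record qpath := QPath {
  pdata : vertex Q * seq (arrow Q);
  pdataP : chain pdata.1 pdata.2 }.

HB.instance Definition _ := [isSub for pdata].
HB.instance Definition _ := [Choice of qpath by <:].

Definition pstart (p : qpath) : vertex Q := (pdata p).1.
Definition parrows (p : qpath) : seq (arrow Q) := (pdata p).2.
Definition pend (p : qpath) : vertex Q := last (pstart p) (map tgt (parrows p)).
Definition plen (p : qpath) : nat := size (parrows p).

Lemma chain_cat e s t :
  chain e (s ++ t) = chain e s && chain (last e (map tgt s)) t.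
Proof. by elim: s e => //= a s IH e; rewrite IH andbA. Qed.

Definition vpath (e : vertex Q) : qpath := @QPath (e, [::]) isT.

Lemma apath_subproof (a : arrow Q) : chain (src a) [:: a].
Proof. by rewrite /= eqxx. Qed.
Definition apath (a : arrow Q) : qpath := @QPath (_, _) (apath_subproof a).

Lemma pcomp_subproof (p q : qpath) : pend p = pstart q ->
  chain (pstart p) (parrows p ++ parrows q).
Proof. by move=> pq; rewrite chain_cat pdataP -/(pend p) pq pdataP. Qed.

(* [pcomp q p] is qp, "q after p", if that is a path. *)
Definition pcomp (q p : qpath) : option qpath :=
  if @eqP _ (pend p) (pstart q) is ReflectT h
  then Some (@QPath (_, _) (pcomp_subproof h)) else None.

Lemma qpath_eq p q : pstart p = pstart q -> parrows p = parrows q -> p = q.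
Proof.
rewrite /pstart /parrows => s a; apply: val_inj => /=.
by rewrite [LHS]surjective_pairing [RHS]surjective_pairing s a.
Qed.

Lemma pcomp_Some q p r : pcomp q p = Some r <->
  [/\ pend p = pstart q, pstart r = pstart p & parrows r = parrows p ++ parrows q].
Proof.
rewrite /pcomp; case: eqP => h; split=> //; last by case.
  by case=> <-.
by case=> _ rs ra; congr Some; apply: qpath_eq; rewrite ?rs ?ra.
Qed.

Lemma pcomp_None q p : pcomp q p = None <-> pend p <> pstart q.
Proof. by rewrite /pcomp; case: eqP. Qed.

Lemma pend_pcomp q p r : pcomp q p = Some r -> pend r = pend q.
Proof.
move=> /pcomp_Some[h rs ra].
by rewrite /pend rs ra map_cat last_cat -/(pend p) h.
Qed.

Lemma pcompA r q p :
  obind (fun rq => pcomp rq p) (pcomp r q) = obind (pcomp r) (pcomp q p).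
Proof.
case rqE: (pcomp r q) => [rq|] /=; case qpE: (pcomp q p) => [qp|] //=.
- have [h1 s1 a1] := (pcomp_Some _ _ _).1 rqE.
  have [h2 s2 a2] := (pcomp_Some _ _ _).1 qpE.
  case E: (pcomp r qp) => [w|].
    have [h3 s3 a3] := (pcomp_Some _ _ _).1 E.
    by apply/pcomp_Some; split; rewrite ?s1 ?s3 ?s2 ?a3 ?a2 ?a1 ?catA.
  by move/pcomp_None: E; rewrite (pend_pcomp qpE).
- have [h1 s1 a1] := (pcomp_Some _ _ _).1 rqE.
  by apply/pcomp_None; rewrite s1; apply/pcomp_None.
- by apply/esym/pcomp_None; rewrite (pend_pcomp qpE); apply/pcomp_None.
Qed.

(* For j at most the length of [p], the right subpath of [p] of length j. *)
Lemma ini_subproof p j : chain (pstart p) (take j (parrows p)).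
Proof.
by have := pdataP p; rewrite -/(parrows p) -{1}(cat_take_drop j (parrows p))
  chain_cat => /andP[].
Qed.
Definition ini (p : qpath) (j : nat) : qpath := @QPath (_, _) (ini_subproof p j).

Definition right_subpath (u p : qpath) : bool :=
  (pstart u == pstart p) && prefix (parrows u) (parrows p).

Lemma right_subpathP u p :
  reflect (exists u', pcomp u' u = Some p) (right_subpath u p).
Proof.
apply: (iffP andP) => [[/eqP us /prefixP[s ps]]|[u' /pcomp_Some[_ -> ->]]].
  have hs : chain (pend u) s.
    by have := pdataP p; rewrite -/(parrows p) -/(pstart p) ps -us chain_cat
      => /andP[].
  by exists (@QPath (pend u, s) hs); apply/pcomp_Some.
by rewrite eqxx prefix_prefix.
Qed.

Lemma right_subpath_ini u p :
  reflect (exists j : 'I_(plen p).+1, u = ini p j) (right_subpath u p).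
Proof.
apply: (iffP andP) => [[/eqP us up]|[j ->]]; last first.
  by rewrite eqxx prefix_take.
have lu : (plen u < (plen p).+1)%N by rewrite ltnS; exact: size_prefix.
exists (Ordinal lu); apply: val_inj => /=.
case: u us up {lu} => -[v s] us /= us'; rewrite /parrows /= prefixE => /eqP h.
by rewrite /plen /parrows /= -/(parrows p) h; congr pair.
Qed.

Lemma plen_ini p (j : 'I_(plen p).+1) : plen (ini p j) = j.
Proof. by rewrite /plen /= size_takel // -ltnS. Qed.

Definition detour (p : qpath) (a : arrow Q) (u : qpath) : bool :=
  [&& right_subpath u p,
      (if pcomp (apath a) u is Some au then ~~ right_subpath au p else false) &
      [exists j : 'I_(plen p).+1, (plen u < j)%N && (pend (ini p j) == tgt a)]].

(* The set D of triples (a, u, i): right subpaths of [p] are given by their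
   lengths, and the index i of v_i(a, u) is the length of v_i(a, u). *)
Definition detour_index (p : qpath) : finType :=
  {t : arrow Q * 'I_(plen p).+1 * 'I_(plen p).+1 |
    [&& detour p t.1.1 (ini p t.1.2), (t.1.2 < t.2)%N &
        pend (ini p t.2) == tgt t.1.1]}.

Definition dtr_arrow p (d : detour_index p) : arrow Q := (val d).1.1.
Definition dtr_len p (d : detour_index p) : 'I_(plen p).+1 := (val d).1.2.
Definition dtr_v p (d : detour_index p) : qpath := ini p (val d).2.

Definition passes_through l (e : 'I_l.+1 -> vertex Q) (p : qpath) : bool :=
  pstart p :: map tgt (parrows p) == codom e.

(* Under condition (N) there is at most one such path. *)
Definition path_through l (e : 'I_l.+1 -> vertex Q) : option qpath :=
  if pselect (exists p, passes_through e p) is left h then Some (xchoose h)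
  else None.

End Paths.

From mathcomp.multinomials Require Import monalg.

Definition path_algebra (K : fieldType) (Q : quiver) : Type := {malg K[qpath Q]}.
HB.instance Definition _ (K : fieldType) (Q : quiver) :=
  GRing.Lmodule.on (path_algebra K Q).

(* The basis vector given by a path; it is locked because unification must not
   unfold it. *)
HB.lock Definition pvec (K : fieldType) (Q : quiver) (p : qpath Q) :
  path_algebra K Q := << p >>.
Canonical pvec_unlockable := Unlockable pvec.unlock.
Arguments pvec {K Q} p.

Section PathAlgebra.
Variables (K : fieldType) (Q : quiver).
Local Notation path_algebra := (path_algebra K Q).

Section LinearExtension.
Variables (V : lmodType K) (F : qpath Q -> V).
Definition lext (x : path_algebra) : V := \sum_(p <- msupp x) mcoeff p x *: F p.

Lemma lextEw (x : path_algebra) (d : {fset qpath Q}) :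
  (msupp x `<=` d)%fset -> lext x = \sum_(p <- d) mcoeff p x *: F p.
Proof.
move=> xd; rewrite /lext (big_fset_incl _ xd) // => p _.
by rewrite -mcoeff_eq0 => /eqP->; rewrite scale0r.
Qed.

Lemma lext_is_linear : linear lext.
Proof.
move=> a x y; set d := (msupp (a *: x + y) `|` (msupp x `|` msupp y))%fset.
have d1 : (msupp (a *: x + y) `<=` d)%fset by rewrite fsubsetUl.
have d2 : (msupp x `<=` d)%fset by rewrite /d fsubsetU // fsubsetUl orbT.
have d3 : (msupp y `<=` d)%fset by rewrite /d fsubsetU // fsubsetUr orbT.
rewrite (lextEw d1) (lextEw d2) (lextEw d3).
rewrite scaler_sumr -big_split /=; apply: eq_bigr => p _.
by rewrite mcoeffD mcoeffZ scalerDl scalerA.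
Qed.
HB.instance Definition _ := GRing.isLinear.Build K path_algebra V *:%R lext
  lext_is_linear.

Lemma lext_pvec p : lext (pvec p) = F p.
Proof.
by rewrite /lext pvec.unlock msuppU oner_eq0 big_seq_fset1 mcoeffUU scale1r.
Qed.
End LinearExtension.

Lemma scale_pvec (a : K) (p : qpath Q) : a *: pvec p = << a *g p >>.
Proof.
rewrite pvec.unlock; apply/malgP => q; apply: etrans (mcoeffZ _ _ _) _.
apply: etrans (congr1 ( *%R a) (mcoeffU p 1 q)) _.
by apply: etrans (esym (mcoeffU p a q)); rewrite mulr_natr.
Qed.

Lemma path_algebraE (x : path_algebra) : x = lext pvec x.
Proof.
by rewrite {1}[x]monalgE /lext; apply: eq_bigr => p _; rewrite scale_pvec.
Qed.

Lemma path_algebra_ext (V : lmodType K) (f g : {linear path_algebra -> V}) :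
  (forall p, f (pvec p) = g (pvec p)) -> f =1 g.
Proof.
move=> fg x; rewrite [x]path_algebraE /lext !linear_sum.
by apply: eq_bigr => p _; rewrite !linearZ fg.
Qed.

Definition pmul (q p : qpath Q) : path_algebra :=
  if pcomp q p is Some r then pvec r else 0.

End PathAlgebra.

HB.lock Definition pa_mul (K : fieldType) (Q : quiver)
    (x y : path_algebra K Q) : path_algebra K Q :=
  lext (fun q => lext (pmul K q) y) x.
Canonical pa_mul_unlockable := Unlockable pa_mul.unlock.

Section PathAlgebraRing.
Variables (K : fieldType) (Q : quiver).
Local Notation path_algebra := (path_algebra K Q).
Local Notation pmul := (@pmul K Q).
Local Notation pa_mul := (@pa_mul K Q).

Definition pa_one : path_algebra := \sum_(e : vertex Q) pvec (vpath e).

Lemma pa_mulDl : left_distributive pa_mul +%R.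
Proof. by move=> x y z; rewrite pa_mul.unlock linearD. Qed.
Lemma pa_mulZl a x y : pa_mul (a *: x) y = a *: pa_mul x y.
Proof. by rewrite pa_mul.unlock linearZ. Qed.
Lemma pa_mulDr : right_distributive pa_mul +%R.
Proof.
move=> x y z; rewrite pa_mul.unlock /lext -big_split /=; apply: eq_bigr => q _.
by rewrite -scalerDr -/(lext _ _) linearD.
Qed.
Lemma pa_mulZr a x y : pa_mul x (a *: y) = a *: pa_mul x y.
Proof.
rewrite pa_mul.unlock {1 3}/lext scaler_sumr; apply: eq_bigr => q _.
by rewrite linearZ /= !scalerA mulrC.
Qed.
Lemma pa_mul_pvec q p : pa_mul (pvec q) (pvec p) = pmul q p.
Proof. by rewrite pa_mul.unlock !lext_pvec. Qed.


Definition pa_rmul y x := pa_mul x y.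
Lemma pa_rmul_linear y : linear (pa_rmul y).
Proof. by move=> a u v; rewrite /pa_rmul pa_mulDl pa_mulZl. Qed.
HB.instance Definition _ y := GRing.isLinear.Build K path_algebra path_algebra
  *:%R (pa_rmul y) (pa_rmul_linear y).
Lemma pa_mulr_linear x : linear (pa_mul x).
Proof. by move=> a u v; rewrite pa_mulDr pa_mulZr. Qed.
HB.instance Definition _ x := GRing.isLinear.Build K path_algebra path_algebra
  *:%R (pa_mul x) (pa_mulr_linear x).

Lemma pa_mul0r y : pa_mul 0 y = 0. Proof. exact: (linear0 (pa_rmul y)). Qed.
Lemma pa_mulr0 x : pa_mul x 0 = 0. Proof. exact: (linear0 (pa_mul x)). Qed.

Lemma pa_mulA_pvec r q p :
  pa_mul (pvec r) (pa_mul (pvec q) (pvec p)) =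
  pa_mul (pa_mul (pvec r) (pvec q)) (pvec p).
Proof.
rewrite [pa_mul (pvec q) _]pa_mul_pvec [pa_mul (pvec r) (pvec q)]pa_mul_pvec.
rewrite /pmul; have := pcompA r q p.
case: (pcomp r q) => [rq|]; case: (pcomp q p) => [qp|] /=.
- by rewrite !pa_mul_pvec /pmul => ->.
- by rewrite pa_mulr0 pa_mul_pvec /pmul => ->.
- by rewrite pa_mul0r pa_mul_pvec /pmul => <-.
- by rewrite pa_mul0r pa_mulr0.
Qed.

Lemma pa_mulA : associative pa_mul.
Proof.
move=> x y z; rewrite -[RHS]/(pa_rmul z (pa_rmul y x)) -/(pa_rmul _ x).
apply: (path_algebra_ext (f := pa_rmul (pa_mul y z))
  (g := pa_rmul z \o pa_rmul y)) => r {x} /=.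
apply: (path_algebra_ext (f := pa_mul (pvec r) \o pa_rmul z)
  (g := pa_rmul z \o pa_mul (pvec r))) => q {y} /=.
apply: (path_algebra_ext (f := pa_mul (pvec r) \o pa_mul (pvec q))
  (g := pa_mul (pa_mul (pvec r) (pvec q)))) => p {z} /=.
exact: pa_mulA_pvec.
Qed.

Lemma pa_mul1l : left_id pa_one pa_mul.
Proof.
apply: (path_algebra_ext (f := pa_mul pa_one) (g := idfun)) => p /=.
rewrite /pa_one -/(pa_rmul _ _) (linear_sum (pa_rmul _)) (bigD1 (pend p)) //=.
rewrite /pa_rmul pa_mul_pvec {1}/pmul (_ : pcomp _ p = Some p); last first.
  by apply/pcomp_Some; split; rewrite ?cats0.
rewrite big1 ?addr0 // => e; rewrite pa_mul_pvec /pmul eq_sym => /eqP ep.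
by rewrite (_ : pcomp _ p = None) //; apply/pcomp_None.
Qed.

Lemma pa_mul1r : right_id pa_one pa_mul.
Proof.
apply: (path_algebra_ext (f := pa_rmul pa_one) (g := idfun)) => p /=.
rewrite /pa_rmul /pa_one (linear_sum (pa_mul _)) (bigD1 (pstart p)) //=.
rewrite pa_mul_pvec {1}/pmul (_ : pcomp p _ = Some p); last first.
  by apply/pcomp_Some.
rewrite big1 ?addr0 // => e; rewrite pa_mul_pvec /pmul => /eqP ep.
by rewrite (_ : pcomp p _ = None) //; apply/pcomp_None.
Qed.

(* As a quiver may have no vertex, the path algebra may be trivial: it is a
   [pzRingType] and a [lmodType K] rather than an [algType K]. *)
HB.instance Definition _ := GRing.Zmodule_isPzRing.Build path_algebra
  pa_mulA pa_mul1l pa_mul1r pa_mulDl pa_mulDr.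

Lemma pvecM q p : pvec q * pvec p = if pcomp q p is Some r then pvec r else 0.
Proof. exact: pa_mul_pvec. Qed.
Lemma path_algebra_scaleAl (a : K) (x y : path_algebra) :
  a *: (x * y) = (a *: x) * y.
Proof. by rewrite /GRing.mul /= pa_mulZl. Qed.
Lemma path_algebra_scaleAr (a : K) (x y : path_algebra) :
  a *: (x * y) = x * (a *: y).
Proof. by rewrite /GRing.mul /= pa_mulZr. Qed.

Definition arrow_ideal : twoSidedIdeal path_algebra :=
  ideal_span [set x | exists a, x = pvec (apath a)].

(* The powers of the arrow ideal are taken in the left regular module. *)
Definition arrow_power (m : nat) : submodClosed path_algebra^o :=
  powm path_algebra^o [set x | x \in arrow_ideal] m.

Definition admissible (I : twoSidedIdeal path_algebra) : Prop :=
  {subset I <= arrow_power 2} /\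
  exists m, (2 <= m)%N /\ {subset arrow_power m <= I}.

End PathAlgebraRing.

Section BoundAlgebra.
Variables (K : fieldType) (Q : quiver) (I : twoSidedIdeal (path_algebra K Q)).
Local Notation KQ := (path_algebra K Q).

Definition bound_algebra : Type := Quotient.quot I.
HB.instance Definition _ := ZmodQuotient.on bound_algebra.

Definition bcls (x : KQ) : bound_algebra := \pi_bound_algebra x.

Lemma bcls_zmod : zmod_morphism bcls.
Proof. by move=> x y; rewrite /bcls raddfB. Qed.
HB.instance Definition _ := GRing.isZmodMorphism.Build KQ bound_algebra bcls
  bcls_zmod.

Lemma bclsK (v : bound_algebra) : bcls (repr v) = v.
Proof. exact: reprK. Qed.
Lemma bcls_eq x y : bcls x = bcls y <-> x - y \in I.
Proof.
by rewrite (Quotient.idealrBE I); split=> h; apply/eqP.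
Qed.
Lemma repr_bcls x : x - repr (bcls x) \in I.
Proof. by apply/bcls_eq; rewrite bclsK. Qed.

Definition bmul (v w : bound_algebra) : bound_algebra := bcls (repr v * repr w).
Definition bscale (a : K) (v : bound_algebra) : bound_algebra :=
  bcls (a *: repr v).

Lemma bclsM x y : bcls (x * y) = bmul (bcls x) (bcls y).
Proof.
apply/bcls_eq; set x' := repr _; set y' := repr _.
have -> : x * y - x' * y' = (x - x') * y + x' * (y - y').
  by rewrite mulrBl mulrBr addrA subrK.
by apply: rpredD; [apply: idealMr|apply: idealMl]; exact: repr_bcls.
Qed.

Lemma bclsZ a x : bcls (a *: x) = bscale a (bcls x).
Proof.
apply/bcls_eq; rewrite -scalerBr -[X in a *: X]mul1r path_algebra_scaleAl.
by apply: idealMl; exact: repr_bcls.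
Qed.

Lemma bmulA : associative bmul.
Proof.
move=> u v w; rewrite -[u]bclsK -[v]bclsK -[w]bclsK.
by rewrite -!bclsM mulrA.
Qed.
Lemma bmul1l : left_id (bcls 1) bmul.
Proof. by move=> v; rewrite -[v]bclsK -bclsM mul1r. Qed.
Lemma bmul1r : right_id (bcls 1) bmul.
Proof. by move=> v; rewrite -[v]bclsK -bclsM mulr1. Qed.
Lemma bmulDl : left_distributive bmul +%R.
Proof.
move=> u v w; rewrite -[u]bclsK -[v]bclsK -[w]bclsK.
by rewrite -raddfD -!bclsM mulrDl raddfD.
Qed.
Lemma bmulDr : right_distributive bmul +%R.
Proof.
move=> u v w; rewrite -[u]bclsK -[v]bclsK -[w]bclsK.
by rewrite -raddfD -!bclsM mulrDr raddfD.
Qed.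
HB.instance Definition _ := GRing.Zmodule_isPzRing.Build bound_algebra
  bmulA bmul1l bmul1r bmulDl bmulDr.

Lemma bscaleA a b v : bscale a (bscale b v) = bscale (a * b) v.
Proof. by rewrite -[v]bclsK -!bclsZ scalerA. Qed.
Lemma bscale1 : left_id 1 bscale.
Proof. by move=> v; rewrite -[v]bclsK -bclsZ scale1r. Qed.
Lemma bscaleDr : right_distributive bscale +%R.
Proof.
move=> a v w; rewrite -[v]bclsK -[w]bclsK.
by rewrite -raddfD -!bclsZ scalerDr raddfD.
Qed.
Lemma bscaleDl v : {morph bscale^~ v : a b / a + b}.
Proof. by move=> a b; rewrite -[v]bclsK -!bclsZ scalerDl raddfD. Qed.
Lemma bscale0 v : bscale 0 v = 0.
Proof. by rewrite -[v]bclsK -bclsZ scale0r raddf0. Qed.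
HB.instance Definition _ := GRing.Nmodule_isLSemiModule.Build K bound_algebra
  bscaleA bscale0 bscale1 bscaleDr bscaleDl.

Lemma bcls_monoid_morphism : monoid_morphism bcls.
Proof. split; [exact: erefl | exact: bclsM]. Qed.
HB.instance Definition _ := GRing.isMonoidMorphism.Build KQ bound_algebra bcls
  bcls_monoid_morphism.
Lemma bcls_scalable : scalable bcls.
Proof. exact: bclsZ. Qed.
HB.instance Definition _ := GRing.isScalable.Build K KQ bound_algebra *:%R bcls
  bcls_scalable.

Lemma bound_algebra_scaleAl (a : K) (u v : bound_algebra) :
  a *: (u * v) = (a *: u) * v.
Proof.
have := congr1 bcls (path_algebra_scaleAl a (repr u) (repr v)).
by rewrite bclsZ !bclsM bclsZ !bclsK.
Qed.
Lemma bound_algebra_scaleAr (a : K) (u v : bound_algebra) :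
  a *: (u * v) = u * (a *: v).
Proof.
have := congr1 bcls (path_algebra_scaleAr a (repr u) (repr v)).
by rewrite bclsZ !bclsM bclsZ !bclsK.
Qed.

Definition pcls (p : qpath Q) : bound_algebra := bcls (pvec p).

End BoundAlgebra.

Section UniserialVarieties.
Variables (K : fieldType) (Q : quiver) (I : twoSidedIdeal (path_algebra K Q)).
Local Notation KQ := (path_algebra K Q).
Local Notation Lambda := (bound_algebra I).
Implicit Types (p u : qpath Q) (U : lmodType Lambda).

Definition vertex_proj (e : vertex Q) : lmodType Lambda :=
  submod (span [set pcls I (vpath e) : Lambda^o]).
(* Lambda e / J e, since J (Lambda e) = J e. *)
Definition vertex_simple (e : vertex Q) : lmodType Lambda :=
  quotmod (radm (vertex_proj e) 1).

Definition has_mast U p : Prop :=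
  [/\ uniserial U, has_length U (plen p).+1 & exists x : U, pcls I p *: x <> 0].

Definition is_mast p : Prop := exists U, has_mast U p.

Definition top_element U (x : U) : Prop :=
  x \notin radm U 1 /\ exists e, x = pcls I (vpath e) *: x.

Definition condition_N : Prop :=
  forall (a : arrow Q) p, is_mast p -> (0 < plen p)%N ->
  pstart p = src a -> pend p = tgt a ->
  (exists z : KQ, pvec p = z * pvec (apath a)) \/
  (exists z : KQ, pvec p = pvec (apath a) * z).

(* The i-th summand below is k_i(a, u) v_i(a, u) x, for u := ini p j. *)
Definition realizes p (k : {ffun detour_index p -> K}) U : Prop :=
  has_mast U p /\
  exists2 x : U, top_element x &
    forall (a : arrow Q) (j : 'I_(plen p).+1), detour p a (ini p j) ->
      pcls I (apath a) *: (pcls I (ini p j) *: x) =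
      \sum_(d : detour_index p | (dtr_arrow d == a) && (dtr_len d == j))
        (k d *: pcls I (dtr_v d)) *: x.

Definition V_path p : set {ffun detour_index p -> K} :=
  [set k | exists U, realizes k U].

Definition Phi_path p (k : {ffun detour_index p -> K}) : lmodType Lambda -> Prop :=
  fun M => exists2 U, realizes k U & module_iso M U.

Definition opt_detour_index (o : option (qpath Q)) : finType :=
  if o is Some p then detour_index p else void.

Definition V_opt (o : option (qpath Q)) : set {ffun opt_detour_index o -> K} :=
  if o is Some p then @V_path p else set0.

(* The value for [None] is irrelevant: V_S is empty in that case. *)
Definition Phi_opt (o : option (qpath Q)) :
    {ffun opt_detour_index o -> K} -> lmodType Lambda -> Prop :=
  if o is Some p then @Phi_path p else fun _ _ => False.

Section Sequence.
Variables (l : nat) (S : 'I_l.+1 -> lmodType Lambda) (e : 'I_l.+1 -> vertex Q).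

Definition simple_sequence : Prop :=
  forall i, simple_module (S i) /\ module_iso (S i) (vertex_simple (e i)).

Definition V_seq : set {ffun opt_detour_index (path_through e) -> K} :=
  @V_opt (path_through e).

Definition Phi_seq : {ffun opt_detour_index (path_through e) -> K} ->
    lmodType Lambda -> Prop := @Phi_opt (path_through e).

Definition uniserial_types (C : lmodType Lambda -> Prop) : Prop :=
  exists2 U, has_series U S & C = iso_class U.

End Sequence.

End UniserialVarieties.
Arguments V_seq {K Q} I {l} e.
Arguments Phi_seq {K Q} I {l} e.

(* [set_bij], for types that are too large for [set]. *)
Definition bijective_between (A B : Type) (P : A -> Prop) (P' : B -> Prop)
    (f : A -> B) : Prop :=
  [/\ forall a, P a -> P' (f a),
      forall a a', P a -> P a' -> f a = f a' -> a = a' &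
      forall b, P' b -> exists2 a, P a & f a = b].

(* Main.v *)
(* The variety is encoded by a quiver of consecutive gadgets.  Gadget i is a
   vertex with an incoming arrow, a loop and an outgoing arrow, and the path p
   runs once through every arrow, in order.  The only detours on p leave a
   gadget without having run through its loop, so a point of V_p assigns to
   each gadget i one scalar k_i, and a path that skips the loops of a set T of
   gadgets acts on a top element as the product of the k_i, i in T, times p.
   Hence the linear relations between these paths are the multilinear
   polynomials in the k_i.  With enough gadgets for each coordinate, such
   polynomials cut out a copy of V: they identify the gadgets of one coordinate
   and then express all equations of V of bounded degree, which suffice by
   Hilbert's basis theorem.  The ideal I is not given by generators: it consists
   of the elements of the square of the arrow ideal that annihilate the uniserial
   modules K^(l+1) attached to the points of V.

   The vertex at which p starts is not visited again, so that top elements are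
   unique up to a scalar, which gives the injectivity of Phi.  The gadgets are
   separated by arrows that are the only ones out of their start or into their
   end, so that every path parallel to an arrow starts or ends with it, which is
   condition (N). *)

From HB Require Import structures.
Require Import Defs.
From mathcomp Require Import all_boot all_order all_algebra.
From mathcomp Require Import zify.
From mathcomp.multinomials Require Import mpoly.
From mathcomp Require Import boolp classical_sets functions cardinality.
Import Defs.

Set Implicit Arguments.
Unset Strict Implicit.
Unset Printing Implicit Defensive.

Import GRing.Theory.
Local Open Scope ring_scope.
Local Open Scope quotient_scope.
Local Open Scope classical_set_scope.

(** * Submodules and the Jacobson radical *)

Section PropSubmodules.
Variables (R : pzRingType) (U : lmodType R).
Implicit Types (P X : set U) (N M : submodClosed U) (A : set R).

(** The two inclusions between V_p and the copy W of V pull in opposite directions: every point of W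
    needs a module over Lambda, and every other point needs a relation of Lambda that excludes it.
    Taking for I whatever annihilates the modules attached to W makes the first inclusion automatic.
    For the second it suffices to find, for a given point outside W, one multilinear polynomial that
    vanishes on W but not there: read as a combination of the paths skipping loops, all of which
    have the same ends as p, it lies in I, yet it would act on a top element as a nonzero multiple
    of p. These paths have length at least 2, so the square of the arrow ideal contains them. The
    modules are triangular of one fixed dimension, so a high power of the arrow ideal annihilates
    them all; this gives admissibility.

    Only squarefree monomials arise because p runs through each loop once. A power of a coordinate
    therefore needs several gadgets carrying the same value, and as the quiver fixes their number, a
    bound on the degrees must be known before the quiver is built. *)

Definition lin_closed P := P 0 /\ forall a x y, P x -> P y -> P (a *: x + y).

Definition prop_pred P of lin_closed P : {pred U} := fun x => `[< P x >].
Lemma prop_pred_closed P (cP : lin_closed P) : submod_closed (prop_pred cP).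
Proof.
case: (cP) => P0 PD; split=> [|a x y]; first exact/asboolP.
by move=> /asboolP Px /asboolP Py; apply/asboolP; exact: PD.
Qed.
HB.instance Definition _ P (cP : lin_closed P) :=
  GRing.isSubmodClosed.Build R U (prop_pred cP) (prop_pred_closed cP).
Definition prop_submod P (cP : lin_closed P) : submodClosed U := prop_pred cP.

Lemma prop_submodP P (cP : lin_closed P) x : reflect (P x) (x \in prop_submod cP).
Proof. exact: asboolP. Qed.

Lemma lin_closed_mem N : lin_closed [set x | x \in N].
Proof. by split=> [|a x y] /=; [exact: rpred0 | exact: (submodP N).2]. Qed.

Lemma mem_fullm x : x \in fullm U. Proof. by []. Qed.
Lemma mem_zerom x : (x \in zerom U) = (x == 0). Proof. by []. Qed.

Lemma mem_span X x : X x -> x \in span X.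
Proof. by move=> Xx; apply/asboolP => N; exact. Qed.

(** A span is the intersection of the submodules above [X], so induction on it is its definition
    applied to [prop_submod cP]; [smulm_ind] and [radm_ind] descend from it. *)
Lemma span_ind P X : lin_closed P -> X `<=` P -> forall x, x \in span X -> P x.
Proof.
move=> cP XP x /asboolP/(_ (prop_submod cP)) h; apply/(prop_submodP cP)/h.
by move=> y /XP Py; apply/prop_submodP.
Qed.

Lemma lin_closed_cyclic (x : U) : lin_closed [set y | exists a : R, y = a *: x].
Proof.
split=> [|c _ _ [a ->] [b ->]]; first by exists 0; rewrite scale0r.
by exists (c * a + b); rewrite scalerDl scalerA.
Qed.

Lemma span1P (x y : U) : y \in span [set x] <-> exists a : R, y = a *: x.
Proof.
split; first by apply: (span_ind (lin_closed_cyclic x)) => _ ->; exists 1; rewrite scale1r.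
by case=> a ->; apply: (@rpredZ _ _ (span [set x])); exact: mem_span.
Qed.

Lemma mem_smulm A N a x : A a -> x \in N -> a *: x \in smulm A N.
Proof. by move=> Aa Nx; apply: mem_span; exists a, x. Qed.

Lemma smulm_ind P A N : lin_closed P ->
  (forall a x, A a -> x \in N -> P (a *: x)) -> forall x, x \in smulm A N -> P x.
Proof. by move=> cP PA; apply: (span_ind cP) => _ [a [x [Aa Nx ->]]]; exact: PA. Qed.

Lemma smulm_le A N : {subset smulm A N <= N}.
Proof.
by apply: (smulm_ind (lin_closed_mem N)) => a x _ Nx; exact: rpredZ.
Qed.

Lemma powm_le A i j : (i <= j)%N -> {subset powm U A j <= powm U A i}.
Proof.
by move=> /subnK <-; elim: (j - i)%N => // k IH x /smulm_le; exact: IH.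
Qed.

Lemma val_submodZ N a (x : submod N) : val (a *: x) = a *: val x.
Proof. by rewrite linearZ. Qed.

Lemma val_submodD N : {morph (val : submod N -> U) : x y / x + y}.
Proof. exact: linearD. Qed.

Lemma val_submodB N : {morph (val : submod N -> U) : x y / x - y}.
Proof. exact: linearB. Qed.

End PropSubmodules.

(** Filtrations multiply: A^k sends A^i U into A^(k+i) U. The induction peels the factors of A off
    [y] by associativity. It serves both the radical and the arrow ideal. *)
Lemma powm_act (R : pzRingType) (A : set R) (U : lmodType R) k i y (u : U) :
  y \in powm R^o A k -> u \in powm U A i -> (y : R) *: u \in powm U A (k + i)%N.
Proof.
move=> + hu; elim: k y => [|k IH]; first by move=> y _; exact: rpredZ.
apply: smulm_ind; first split=> [|a x y hx hy] /=.
- by rewrite scale0r; exact: rpred0.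
- by rewrite scalerDl -scalerA; exact: (lin_closed_mem (powm U A (k.+1 + i))).2.
move=> a x Aa hx.
rewrite /= [X in X \in _](_ : _ = a *: ((x : R) *: u)); last exact/esym/scalerA.
by apply: mem_smulm => //; exact: IH.
Qed.

Section Jacobson.
Variable R : pzRingType.
Local Notation J := (jacobson_radical (R := R)).

Lemma jacobson_closed : lin_closed (U := R^o) J.
Proof.
split=> [N _|a x y Jx Jy N mN]; first exact: rpred0.
by apply: (lin_closed_mem N).2; [exact: Jx | exact: Jy].
Qed.

Lemma jacobsonMl a x : J x -> J (a * x).
Proof.
move=> Jx; have [J0 JD] := jacobson_closed.
by rewrite -[_ * _]addr0; exact: (JD a x 0).
Qed.

(** The annihilator of a nonzero [s] is a maximal left ideal: for a left ideal M above it, M s is 0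
    or everything, and in the latter case s = d s with d in M, so that 1 - d annihilates [s] and 1
    lies in M. *)
Lemma jacobson_simple (S : lmodType R) a (s : S) :
  simple_module S -> J a -> a *: s = 0.
Proof.
move=> [_ simS] Ja; have [->|s0] := eqVneq s 0; first exact: scaler0.
have cA : lin_closed (U := R^o) [set b : R | b *: s = 0].
  split=> [|c x y /= xs ys]; first exact: scale0r.
  by rewrite scalerDl -scalerA xs ys scaler0 addr0.
apply/(prop_submodP cA)/Ja; split=> [h|M AM].
  have /(prop_submodP cA) /= := (h 1 : _ = true).
  by rewrite scale1r => /eqP; rewrite (negPf s0).
have cI : lin_closed [set y : S | exists2 b : R, (b : R^o) \in M & y = b *: s].
  split=> [|c _ _ [b Mb ->] [d Md ->]].
    by exists 0; rewrite ?scale0r //; exact: (rpred0 M).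
  by exists (c * b + d); [exact: (lin_closed_mem M).2|rewrite scalerDl scalerA].
have [z|f] := simS (prop_submod cI); [left|right] => b.
  apply/idP/idP=> [Mb|]; last exact: AM.
  apply/(prop_submodP cA) => /=; apply/eqP; rewrite -mem_zerom -z.
  by apply/prop_submodP; exists b.
have /(prop_submodP cI)[d Md sE] : s \in prop_submod cI by rewrite f.
have M1 : (1 : R^o) \in M.
  have -> : (1 : R^o) = (1 - d) + d by rewrite subrK.
  apply: rpredD => //; apply: AM; apply/prop_submodP => /=.
  by rewrite scalerBl scale1r -sE subrr.
by rewrite mem_fullm -[b]mulr1; exact: (@rpredZ _ _ M b _ M1).
Qed.

(** If a maximal left ideal N missed [a], then 1 = n + b a with n in N. With c = b a, each 1 - c^k
    lies in N by telescoping, and nilpotency of c puts 1 in N. *)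
Lemma jacobson_nilp a : (forall b, exists m, (b * a) ^+ m = 0) -> J a.
Proof.
move=> nil N [Nf maxN]; apply: contrapT => /negP Na.
have cM : lin_closed (U := R^o) [set z : R | exists n b, (n : R^o) \in N /\ z = n + b * a].
  split=> [|c _ _ [n [b [Nn ->]]] [n' [b' [Nn' ->]]]].
    by exists 0, 0; rewrite mul0r addr0; split=> //; exact: (rpred0 N).
  exists (c * n + n'), (c * b + b'); split; first exact: (lin_closed_mem N).2.
  by rewrite /GRing.scale /= mulrDr mulrDl mulrA addrACA.
have NM : {subset N <= prop_submod cM}.
  by move=> n Nn; apply/prop_submodP; exists n, 0; rewrite mul0r addr0.
have Ma : (a : R^o) \in prop_submod cM.
  by apply/prop_submodP; exists 0, 1; rewrite mul1r add0r; split=> //; exact: (rpred0 N).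
have [e|f] := maxN _ NM; first by rewrite -e Ma in Na.
have /(prop_submodP cM)[n [b [Nn n1]]] : (1 : R^o) \in prop_submod cM by rewrite f.
have [m nilm] := nil b; set c := b * a in n1 nilm.
have N1 k : (1 - c ^+ k : R^o) \in N.
  elim: k => [|k IH]; first by rewrite expr0 subrr; exact: (rpred0 N).
  have -> : 1 - c ^+ k.+1 = (1 - c ^+ k) + c ^+ k * n.
    have -> : n = 1 - c by rewrite n1 addrK.
    by rewrite mulrBr mulr1 -exprSr addrA subrK.
  by apply: (rpredD IH); exact: (@rpredZ _ _ N (c ^+ k)).
apply: Nf => z; rewrite mem_fullm -[z]mulr1.
by apply: (@rpredZ _ _ N z); have := N1 m; rewrite nilm subr0.
Qed.

Section Radical.
Variable U : lmodType R.

Lemma mem_radm i a (x : U) : J a -> x \in radm U i -> a *: x \in radm U i.+1.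
Proof. exact: mem_smulm. Qed.

Lemma radm_le i j : (i <= j)%N -> {subset radm U j <= radm U i}.
Proof. exact: powm_le. Qed.

Lemma radm_ind (P : set U) i : lin_closed P ->
  (forall a x, J a -> x \in radm U i -> P (a *: x)) ->
  forall x, x \in radm U i.+1 -> P x.
Proof. exact: smulm_ind. Qed.

End Radical.

End Jacobson.

(** * Triangular representations *)

Section PathInduction.
Variables (K : fieldType) (Q : quiver).
Local Notation KQ := (path_algebra K Q).

Lemma path_algebra_ind (P : KQ -> Prop) :
  P 0 -> (forall a x y, P x -> P y -> P (a *: x + y)) ->
  (forall p, P (pvec p)) -> forall x, P x.
Proof.
move=> P0 PD Pp x; rewrite [x]path_algebraE /lext.
by elim/big_rec: _ => // p y _ Py; exact: PD.
Qed.

Lemma parrows_cons (p : qpath Q) a s : parrows p = a :: s ->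
  exists p', [/\ parrows p' = s, pcomp p' (apath a) = Some p & pstart p' = tgt a].
Proof.
case: p => -[e t] /= h; rewrite /parrows /= => tE; move: h; rewrite tE /=.
move=> h; have /andP[/eqP ae cs] := h.
exists (@QPath _ (tgt a, s) cs); split=> //; exact/pcomp_Some.
Qed.

Lemma plen0 (p : qpath Q) : plen p = 0%N -> p = vpath (pstart p).
Proof. by move/size0nil => h; apply: qpath_eq. Qed.

End PathInduction.

Section TriangularRepresentations.
Variables (K : fieldType) (Q : quiver).
Local Notation KQ := (path_algebra K Q).

(* A representation of [Q] with a basis compatible with the vertex spaces, on
   which the arrows strictly raise the index. *)
Record trep := TRep {
  rdim : nat;
  rpos : 'I_rdim.+1 -> vertex Q;
  rarr : arrow Q -> 'M[K]_rdim.+1;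
  rarrP : forall a i j, rarr a i j != 0 ->
    [/\ rpos i = tgt a, rpos j = src a & (j < i)%N] }.

Variable M : trep.
Local Notation d := (rdim M).
Local Notation pos := (@rpos M).
Local Notation A := (rarr M).

Definition rproj (v : vertex Q) : 'M[K]_d.+1 :=
  diag_mx (\row_j (pos j == v)%:R).

Definition rpath (p : qpath Q) : 'M[K]_d.+1 :=
  (\prod_(a <- rev (parrows p)) A a) * rproj (pstart p).

Definition rho : KQ -> 'M[K]_d.+1 := lext rpath.
HB.instance Definition _ := GRing.Linear.copy rho (lext rpath).

Lemma rho_pvec p : rho (pvec p) = rpath p. Proof. exact: lext_pvec. Qed.

Lemma rprojM v w : rproj v * rproj w = (v == w)%:R *: rproj v.
Proof.
rewrite /rproj -[_ * _]/(_ *m _) mulmx_diag; apply/matrixP=> i j; rewrite !mxE.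
rewrite [RHS]mulrnAr; congr (_ *+ _); case: eqVneq => [->|]; last by rewrite mul0r mulr0.
by rewrite mul1r mulr1.
Qed.

Lemma rproj_sum : \sum_v rproj v = 1.
Proof.
apply/matrixP=> i j; rewrite summxE !mxE (bigD1 (pos i)) //= !mxE eqxx.
rewrite big1 ?addr0 // => v /negPf vi; rewrite !mxE eq_sym vi.
by rewrite mul0rn.
Qed.

Lemma mulr_proj (B : 'M[K]_d.+1) v :
  (forall i j, B i j != 0 -> pos j = v) -> B * rproj v = B.
Proof.
move=> h; apply/matrixP=> i j; rewrite -[_ * _]/(_ *m _) mul_mx_diag !mxE.
have [->|/h->] := eqVneq (B i j) 0; first by rewrite mul0r.
by rewrite eqxx mulr1.
Qed.

Lemma mul_projr (B : 'M[K]_d.+1) v :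
  (forall i j, B i j != 0 -> pos i = v) -> rproj v * B = B.
Proof.
move=> h; apply/matrixP=> i j; rewrite -[_ * _]/(_ *m _) mul_diag_mx !mxE.
have [->|/h->] := eqVneq (B i j) 0; first by rewrite mulr0.
by rewrite eqxx mul1r.
Qed.

Lemma rpath_pend p : rproj (pend p) * rpath p = rpath p.
Proof.
rewrite /rpath /pend; case/lastP: (parrows p) => [|s a].
  by rewrite big_nil mul1r rprojM eqxx scale1r.
rewrite rev_rcons big_cons map_rcons last_rcons !mulrA.
by rewrite mul_projr // => i j /rarrP[].
Qed.

Lemma rpathM q p :
  rpath q * rpath p = if pcomp q p is Some r then rpath r else 0.
Proof.
case E: (pcomp q p) => [r|].
  move/pcomp_Some: E => [h1 h2 h3].
  by rewrite {1}/rpath -mulrA -h1 rpath_pend /rpath h2 h3 rev_cat big_cat mulrA.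
move/pcomp_None: E => /eqP E; rewrite -(rpath_pend p) {1}/rpath -mulrA.
by rewrite [rproj _ * (_ * _)]mulrA rprojM eq_sym (negPf E) scale0r mul0r mulr0.
Qed.

Lemma rhoM x y : rho (x * y) = rho x * rho y.
Proof.
elim/path_algebra_ind: x => [|a x x' hx hx'|q]; first by rewrite mul0r linear0 mul0r.
  by rewrite mulrDl -path_algebra_scaleAl !linearP /= hx hx' mulrDl scalerAl.
elim/path_algebra_ind: y => [|a x x' hx hx'|p]; first by rewrite mulr0 linear0 mulr0.
  by rewrite mulrDr -path_algebra_scaleAr !linearP /= hx hx' mulrDr scalerAr.
rewrite pvecM !rho_pvec rpathM; case: (pcomp q p) => [r|]; last exact: linear0.
exact: rho_pvec.
Qed.

Lemma rho_vpath v : rho (pvec (vpath v)) = rproj v.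
Proof. by rewrite rho_pvec /rpath big_nil mul1r. Qed.

Lemma rho_apath a : rho (pvec (apath a)) = A a.
Proof.
by rewrite rho_pvec /rpath big_seq1 mulr_proj // => i j /rarrP[].
Qed.

Lemma rho1 : rho 1 = 1.
Proof. by rewrite linear_sum -rproj_sum; apply: eq_bigr => v _; exact: rho_vpath. Qed.

(** The degree of a matrix in the triangular filtration: degree 0 means lower triangular, degrees
    add under products, and a degree above [d] forces the matrix to vanish. *)
Definition raises (k : nat) (B : 'M[K]_d.+1) :=
  forall i j : 'I_d.+1, (i < j + k)%N -> B i j = 0.

Lemma raisesM k k' B B' : raises k B -> raises k' B' -> raises (k + k') (B * B').
Proof.
move=> hB hB' i j ij; rewrite mxE big1 // => t _.
have [it|ti] := ltnP i (t + k); first by rewrite hB ?mul0r.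
rewrite hB' ?mulr0 // -(ltn_add2r k); apply: leq_ltn_trans ti _.
by rewrite -addnA [(k' + k)%N]addnC.
Qed.

Lemma raisesD k a B B' : raises k B -> raises k B' -> raises k (a *: B + B').
Proof. by move=> hB hB' i j ij; rewrite !mxE hB ?hB' // mulr0 addr0. Qed.

Lemma raises0 k : raises k 0. Proof. by move=> i j _; rewrite mxE. Qed.

Lemma raises_rarr a : raises 1 (A a).
Proof.
move=> i j; rewrite addn1 ltnS => ij; apply/eqP; apply: contraTT ij => /rarrP[_ _].
by rewrite ltnNge.
Qed.

Lemma raises_rproj v : raises 0 (rproj v).
Proof. by move=> i j; rewrite addn0 !mxE; case: (eqVneq i j) => [->|]; rewrite ?ltnn. Qed.

Lemma raisesW k B : raises k B -> raises 0 B.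
Proof.
by move=> h i j; rewrite addn0 => ij; apply: h; exact: leq_trans ij (leq_addr _ _).
Qed.

Lemma raises_rho x : raises 0 (rho x).
Proof.
elim/path_algebra_ind: x => [|a x y hx hy|p].
- by rewrite linear0; exact: raises0.
- by rewrite linearP; exact: raisesD.
rewrite rho_pvec; apply: (@raisesM 0 0); last exact: raises_rproj.
elim/big_rec: _ => [|a B _ hB]; last first.
  by apply: (@raisesM 0 0) => //; apply: raisesW (@raises_rarr a).
by move=> i j; rewrite addn0 mxE; case: (eqVneq i j) => [->|//]; rewrite ltnn.
Qed.

(** The arrow ideal is an intersection of ideals, so it is bounded from above by an ideal containing
    the arrows: here, the elements acting by strictly lower triangular matrices. *)
Definition raising_pred : {pred KQ} := fun x => `[< raises 1 (rho x) >].
Lemma raising_zmod : zmod_closed raising_pred.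
Proof.
split=> [|x y /asboolP hx /asboolP hy]; apply/asboolP.
  by rewrite linear0; exact: raises0.
by rewrite linearB -scaleN1r addrC; exact: raisesD.
Qed.
HB.instance Definition _ := GRing.isZmodClosed.Build KQ raising_pred raising_zmod.
Lemma raisingMl a x : x \in raising_pred -> a * x \in raising_pred.
Proof.
by move=> /asboolP hx; apply/asboolP; rewrite rhoM; apply: (@raisesM 0 1) => //;
  exact: raises_rho.
Qed.
Lemma raisingMr a x : x \in raising_pred -> x * a \in raising_pred.
Proof.
by move=> /asboolP hx; apply/asboolP; rewrite rhoM; apply: (@raisesM 1 0) => //;
  exact: raises_rho.
Qed.
HB.instance Definition _ := isTwoSided.Build KQ raising_pred raisingMl raisingMr.

Lemma raises_arrow_ideal x : x \in arrow_ideal K Q -> raises 1 (rho x).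
Proof.
move=> /asboolP/(_ raising_pred) h; apply/(@asboolP (raises 1 (rho x)))/h => _ [a ->] /=.
by apply/asboolP; rewrite rho_apath; exact: raises_rarr.
Qed.

Lemma raises_arrow_power m x : x \in arrow_power K Q m -> raises m (rho x).
Proof.
elim: m x => [|m IH] x; first by move=> _; exact: raises_rho.
have := @smulm_ind _ KQ^o [set x : KQ | raises m.+1 (rho x)]
  [set x | x \in arrow_ideal K Q] (arrow_power K Q m).
apply.
  split=> [|a y z /= hy hz]; first by rewrite /= linear0; exact: raises0.
  have -> : rho (a *: y + z) = 1 *: (rho a * rho y) + rho z.
    by rewrite scale1r -rhoM; exact: (linearD rho (a * y) z).
  by apply: raisesD => //; exact: (@raisesM 0 m.+1 _ _ (raises_rho a) hy).
move=> a y ha hy /=; rewrite rhoM.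
by apply: (@raisesM 1 m); [exact: raises_arrow_ideal|exact: IH].
Qed.

Lemma rho_arrow_power m x : (d < m)%N -> x \in arrow_power K Q m -> rho x = 0.
Proof.
move=> dm /raises_arrow_power h; apply/matrixP=> i j; rewrite h ?mxE //.
by apply: leq_trans (ltn_ord i) _; apply: leq_trans dm _; exact: leq_addl.
Qed.

End TriangularRepresentations.

(** * Modules over a bound path algebra *)

(* Locked, as unification would unfold the scalars through the quotient. *)
HB.lock Definition sc (K : fieldType) (Q : quiver)
    (I : twoSidedIdeal (path_algebra K Q)) (c : K) : bound_algebra I :=
  c *: (1 : bound_algebra I).
Canonical sc_unlockable := Unlockable sc.unlock.

Section BoundAlgebraTheory.
Variables (K : fieldType) (Q : quiver) (I : twoSidedIdeal (path_algebra K Q)).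
Local Notation KQ := (path_algebra K Q).
Local Notation Lambda := (bound_algebra I).
Local Notation J := (jacobson_radical (R := Lambda)).
Local Notation pv e := (pcls I (vpath e)).
Local Notation pa a := (pcls I (apath a)).

Local Notation sc := (sc I).

(** A [Lambda]-module carries no [K]-structure of its own here; the scalars act on it through the
    central elements [sc c]. *)
Lemma sc_mull c (x : Lambda) : c *: x = sc c * x.
Proof. by rewrite sc.unlock -bound_algebra_scaleAl mul1r. Qed.
Lemma sc_mulr c (x : Lambda) : c *: x = x * sc c.
Proof. by rewrite sc.unlock -bound_algebra_scaleAr mulr1. Qed.
Lemma scC c (x : Lambda) : sc c * x = x * sc c.
Proof. by rewrite -sc_mull sc_mulr. Qed.
Lemma sc1 : sc 1 = 1. Proof. by rewrite sc.unlock scale1r. Qed.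
Lemma sc0 : sc 0 = 0. Proof. by rewrite sc.unlock scale0r. Qed.
Lemma scM c c' : sc (c * c') = sc c * sc c'.
Proof. by rewrite -sc_mull sc.unlock scalerA. Qed.
Lemma scD c c' : sc (c + c') = sc c + sc c'.
Proof. by rewrite sc.unlock scalerDl. Qed.
Lemma scN c : sc (- c) = - sc c.
Proof. by apply/eqP; rewrite -addr_eq0 -scD addNr sc0. Qed.
Lemma sc_sum (T : Type) (r : seq T) (P : pred T) (F : T -> K) :
  sc (\sum_(i <- r | P i) F i) = \sum_(i <- r | P i) sc (F i).
Proof. by apply: (big_morph sc); [exact: scD|exact: sc0]. Qed.

Lemma pclsM q p :
  pcls I q * pcls I p = if pcomp q p is Some r then pcls I r else 0.
Proof.
rewrite /pcls -[LHS](bclsM I (pvec q)) pvecM.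
by case: (pcomp q p) => // ; exact: raddf0.
Qed.

Lemma bound_algebra_ind (P : Lambda -> Prop) :
  P 0 -> (forall a x y, P x -> P y -> P (a *: x + y)) ->
  (forall p, P (pcls I p)) -> forall x, P x.
Proof.
move=> P0 PD Pp x; rewrite -[x]bclsK; elim/path_algebra_ind: (repr x).
- by rewrite raddf0.
- by move=> a y z Py Pz; rewrite raddfD /= linearZ; exact: PD.
- exact: Pp.
Qed.

Lemma pv_idem e : pv e * pv e = pv e.
Proof.
by rewrite pclsM; case E: (pcomp _ _) => [r|]; [|move/pcomp_None: E];
  rewrite //; congr pcls; apply: Some_inj; rewrite -E; apply/pcomp_Some.
Qed.

Lemma pv_orth e e' : e != e' -> pv e * pv e' = 0.
Proof.
move=> ee; rewrite pclsM; case E: (pcomp _ _) => [r|] //.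
by move/pcomp_Some: E => -[/esym/eqP]; rewrite /= (negPf ee).
Qed.

Lemma pv_sum : \sum_e pv e = 1.
Proof. by rewrite -[1 in RHS]/(bcls I 1) /= raddf_sum. Qed.

Lemma pcls_pend p : pv (pend p) * pcls I p = pcls I p.
Proof.
rewrite pclsM (_ : pcomp _ _ = Some p) //.
by apply/pcomp_Some; split; rewrite ?cats0.
Qed.

Lemma pcls_pstart p : pcls I p * pv (pstart p) = pcls I p.
Proof. by rewrite pclsM (_ : pcomp _ _ = Some p) //; apply/pcomp_Some. Qed.

Lemma pa_tgt a : pv (tgt a) * pa a = pa a. Proof. exact: (pcls_pend (apath a)). Qed.
Lemma pa_src a : pa a * pv (src a) = pa a. Proof. exact: (pcls_pstart (apath a)). Qed.

Lemma pcls_cons p a s : parrows p = a :: s ->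
  exists2 p', parrows p' = s & pcls I p = pcls I p' * pa a.
Proof.
by move=> /parrows_cons[p' [h1 h2 h3]]; exists p' => //; rewrite pclsM h2.
Qed.

Lemma pcls_word p : pcls I p = (\prod_(a <- rev (parrows p)) pa a) * pv (pstart p).
Proof.
move: {2}(plen p) (erefl (plen p)) => n; rewrite /plen.
elim: n p => [|n IH] p; first by move=> /plen0->; rewrite big_nil mul1r.
case E: (parrows p) => [//|a s] [sn]; have [p' [h1 h2 h3]] := parrows_cons E.
have -> : pcls I p = pcls I p' * pa a by rewrite pclsM h2.
have [_ ps _] := (pcomp_Some _ _ _).1 h2.
rewrite IH ?h1 // h3 -mulrA pa_tgt rev_cons big_rcons /= -mulrA; congr (_ * _).
by rewrite ps pa_src.
Qed.

Lemma radm_act (U : lmodType Lambda) k i y (u : U) :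
  y \in radm Lambda^o k -> u \in radm U i -> y *: u \in radm U (k + i)%N.
Proof. exact: powm_act. Qed.

Section Admissible.
Hypothesis admI : admissible I.

Lemma arrow_powerX x m : x \in arrow_ideal K Q -> x ^+ m \in arrow_power K Q m.
Proof.
by move=> Ax; elim: m => // m IH; rewrite exprS; exact: (@mem_smulm _ KQ^o).
Qed.

(** Any b times an arrow is the class of an element of the arrow ideal, a power of which lies in
    [I]; so it is nilpotent. *)
Lemma jacobson_pa a : J (pa a).
Proof.
have [_ [m [_ hm]]] := admI; apply: jacobson_nilp => b; exists m.
set x := repr b * pvec (apath a).
have -> : b * pa a = bcls I x by rewrite bclsM bclsK.
rewrite -rmorphXn -[0](raddf0 (bcls I)); apply/bcls_eq; rewrite subr0.
apply/hm/arrow_powerX/idealMl/asboolP => T; apply; by exists a.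
Qed.

Lemma jacobson_path p : (0 < plen p)%N -> J (pcls I p).
Proof.
rewrite /plen; case E: (parrows p) => [//|a s] _.
by have [p' _ ->] := pcls_cons E; exact/jacobsonMl/jacobson_pa.
Qed.

(** Paths of length at least 2 lie in J^2 because arrows lie in J. The arrow part is what decides in
    [series_mast] how a radical layer is linked to the next. *)
Lemma bound_decomp (x : Lambda) : exists c f y, y \in radm Lambda^o 2 /\
  x = \sum_e sc (c e) * pv e + \sum_a sc (f a) * pa a + y.
Proof.
elim/bound_algebra_ind: x => [|a x x' [c [f [y [hy ->]]]] [c' [f' [y' [hy' ->]]]]|p].
- exists (fun=> 0), (fun=> 0), 0; split; first exact: rpred0.
  by rewrite !big1 ?addr0 // => i _; rewrite sc0 mul0r.
- exists (fun e => a * c e + c' e), (fun e => a * f e + f' e), (a *: y + y').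
  split; first by apply: rpredD => //; rewrite sc_mull; exact: (@rpredZ _ Lambda^o).
  have h (T : finType) (g g' : T -> K) (F : T -> Lambda) :
     \sum_i sc (a * g i + g' i) * F i = a *: (\sum_i sc (g i) * F i) + \sum_i sc (g' i) * F i.
    rewrite scaler_sumr -big_split; apply: eq_bigr => i _ /=.
    by rewrite scD mulrDl scM sc_mull; congr (_ + _); rewrite mulrA.
  have e (u v w u' v' w' : Lambda) : a *: (u + v + w) + (u' + v' + w') =
      (a *: u + u') + (a *: v + v') + (a *: w + w').
    by rewrite !scalerDr [LHS]addrACA; congr (_ + _); rewrite [LHS]addrACA.
  apply: etrans (e _ _ _ _ _ _) _; congr (_ + _ + _); apply/esym.
    exact: (h _ c c' (fun e => pv e)).
  exact: (h _ f f' (fun i => pa i)).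
case E: (parrows p) => [|a [|b s]].
- exists (fun e => (e == pstart p)%:R), (fun=> 0), 0; split; first exact: rpred0.
  rewrite [X in _ + X + _]big1 ?addr0 => [|i _]; last by rewrite sc0 mul0r.
  rewrite (bigD1 (pstart p)) //= eqxx sc1 mul1r big1 ?addr0; last first.
    by move=> i /negPf->; rewrite sc0 mul0r.
  by rewrite {1}(@plen0 _ p) // /plen E.
- exists (fun=> 0), (fun i => (i == a)%:R), 0; split; first exact: rpred0.
  rewrite [X in X + _ + _]big1 ?addr0 ?add0r => [|i _]; last by rewrite sc0 mul0r.
  rewrite (bigD1 a) //= eqxx sc1 mul1r big1 ?addr0; last first.
    by move=> i /negPf->; rewrite sc0 mul0r.
  congr pcls; apply: qpath_eq; rewrite ?E //=.
  by have := pdataP p; rewrite -/(parrows p) E /= andbT => /eqP/esym.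
- exists (fun=> 0), (fun=> 0), (pcls I p); split; last first.
    by rewrite !big1 ?add0r // => i _; rewrite sc0 mul0r.
  have [p' hp' ->] := pcls_cons E; apply: (@mem_radm _ Lambda^o 1).
    by apply: jacobson_path; rewrite /plen hp'.
  rewrite -[pa a]mulr1; apply: (@mem_radm _ Lambda^o 0) => //; exact: jacobson_pa.
Qed.

Lemma bound_decomp1 (x : Lambda) : exists c y, y \in radm Lambda^o 1 /\
  x = \sum_e sc (c e) * pv e + y.
Proof.
have [c [f [y [hy ->]]]] := bound_decomp x.
exists c, (\sum_a sc (f a) * pa a + y); split; last by rewrite addrA.
apply: rpredD; last exact: (radm_le _ hy).
apply: rpred_sum => a _; apply: (@rpredZ _ Lambda^o); rewrite -[pa a]mulr1.
by apply: (@mem_radm _ Lambda^o 0) => //; exact: jacobson_pa.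
Qed.

End Admissible.

Section RepresentationModule.
Variable (M : trep K Q).
Hypothesis IM : {in I, forall z, rho M z = 0}.

(** The proof that [I] acts by zero is a parameter of the type, so that the [Lambda]-module
    structure declared on it can depend on that proof. *)
Definition repmod of {in I, forall z, rho M z = 0} : Type := 'cV[K]_(rdim M).+1.
HB.instance Definition _ := GRing.Zmodule.on (repmod IM).

Definition ract (x : Lambda) (v : repmod IM) : repmod IM := rho M (repr x) *m v.

Lemma rho_repr x : rho M (repr (bcls I x)) = rho M x.
Proof.
by apply/eqP; rewrite eq_sym -subr_eq0 -linearB /= IM //; exact: repr_bcls.
Qed.

Lemma ract_bcls x v : ract (bcls I x) v = rho M x *m v.
Proof. by rewrite /ract rho_repr. Qed.

Lemma ractA x y v : ract x (ract y v) = ract (x * y) v.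
Proof.
rewrite -[x]bclsK -[y]bclsK -[_ * _](bclsM I) !ract_bcls rhoM.
exact: mulmxA.
Qed.
Lemma ract1 : left_id 1 ract.
Proof. by move=> v; rewrite ract_bcls rho1; exact: mul1mx. Qed.
Lemma ractDr : right_distributive ract +%R.
Proof. by move=> x v w; exact: mulmxDr. Qed.
Lemma ractDl v : {morph ract^~ v : x y / x + y}.
Proof.
move=> x y; rewrite -[x]bclsK -[y]bclsK -raddfD !ract_bcls linearD; exact: mulmxDl.
Qed.
HB.instance Definition _ := GRing.Zmodule_isLmodule.Build Lambda (repmod IM)
  ractA ract1 ractDr ractDl.

Lemma repmod_bcls x (v : repmod IM) : bcls I x *: v = rho M x *m v.
Proof. exact: ract_bcls. Qed.
Lemma repmod_sc c (v : repmod IM) : sc c *: v = (c *: (v : 'cV[K]__)) :> 'cV[K]__.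
Proof.
have -> : sc c = bcls I (c *: (1 : KQ)) by rewrite sc.unlock; exact: (esym (bclsZ I c 1)).
by rewrite repmod_bcls linearZ /= rho1 -scalemxAl mul1mx.
Qed.
End RepresentationModule.

End BoundAlgebraTheory.

(** * Subquotients and the simple modules at the vertices *)

Section Quotients.
Variable R : pzRingType.
Implicit Types U : lmodType R.

Lemma quotmod_eq U (N : submodClosed U) x y :
  \pi_(quotmod N) x = \pi_(quotmod N) y <-> x - y \in N.
Proof. by rewrite (Quotient.idealrBE (as_zmod N)); split=> h; apply/eqP. Qed.

Lemma quotmod_eq0 U (N : submodClosed U) x : \pi_(quotmod N) x = 0 <-> x \in N.
Proof.
have p0 : \pi_(quotmod N) 0 = 0 by exact: raddf0.
by rewrite -p0; split=> [/quotmod_eq|h]; [|apply/quotmod_eq]; rewrite subr0.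
Qed.

Lemma pi_subquot_eq0 U (N M : submodClosed U) (x : submod N) :
  \pi_(quotmod (trace_pred M : submodClosed (submod N))) x = 0 <-> val x \in M.
Proof. exact: quotmod_eq0. Qed.

Lemma jacobson_subquot U (N M : submodClosed U) a x : simple_module (subquot N M) ->
  jacobson_radical a -> x \in N -> a *: x \in M.
Proof.
move=> simS Ja Nx; set y : submod N := Sub x Nx.
have := jacobson_simple (\pi_(quotmod (trace_pred M : submodClosed (submod N))) y) simS Ja.
by rewrite -[_ *: _]pi_quotmod_scale => /pi_subquot_eq0; rewrite linearZ.
Qed.

(** The radical annihilates each simple factor, so each of its powers descends one more step of the
    composition series. *)
Lemma has_length_radm U n (x : U) : has_length U n -> x \in radm U n -> x = 0.
Proof.
move=> [M [M0 Mn hM]]; suff h i : (i <= n)%N -> {subset radm U i <= M (n - i)%N}.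
  by move/(h n (leqnn n)); rewrite subnn M0 => /eqP.
elim: i => [|i IH] ni; first by move=> y _; rewrite subn0 Mn.
have [_ simS] := hM (n - i.+1)%N ltac:(by rewrite -subSn // subSS leq_subr).
apply: radm_ind; first exact: lin_closed_mem.
move=> a y Ja hy; apply: jacobson_subquot simS Ja _.
by rewrite -subSn // subSS; apply: IH => //; exact: ltnW.
Qed.

End Quotients.

Section Isomorphisms.
Variable R : pzRingType.

Lemma module_iso_refl (U : lmodType R) : module_iso U U.
Proof. by exists idfun; exists id. Qed.

Lemma module_iso_trans (U V W : lmodType R) :
  module_iso U V -> module_iso V W -> module_iso U W.
Proof. by move=> [f bf] [g bg]; exists (g \o f); exact: bij_comp. Qed.

End Isomorphisms.

Section Lines.
Variables (K : fieldType) (Q : quiver) (I : twoSidedIdeal (path_algebra K Q)).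
Hypothesis admI : admissible I.
Local Notation KQ := (path_algebra K Q).
Local Notation Lambda := (bound_algebra I).
Local Notation J := (jacobson_radical (R := Lambda)).
Local Notation pv e := (pcls I (vpath e)).
Local Notation pa a := (pcls I (apath a)).
Local Notation sc := (sc I).

Lemma sc_scalerC c a (U : lmodType Lambda) (x : U) : a *: (sc c *: x) = sc c *: (a *: x).
Proof. by rewrite !scalerA scC. Qed.

Lemma scVK c (U : lmodType Lambda) (x : U) : c != 0 -> sc c^-1 *: (sc c *: x) = x.
Proof. by move=> c0; rewrite scalerA -scM mulVf // sc1 scale1r. Qed.

Lemma sc_scaler_eq0 c (U : lmodType Lambda) (x : U) : sc c *: x = 0 -> x != 0 -> c = 0.
Proof.
move=> cx; apply: contraNeq => c0.
by rewrite -(scVK x c0) cx scaler0.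
Qed.

Lemma sc_scaler_inj c c' (U : lmodType Lambda) (x : U) :
  x != 0 -> sc c *: x = sc c' *: x -> c = c'.
Proof.
move=> x0 /eqP; rewrite -subr_eq0 -scalerBl -scN -scD => /eqP/sc_scaler_eq0.
by move=> /(_ x0)/eqP; rewrite subr_eq0 => /eqP.
Qed.

(** The simple module at the vertex [e], described by a generator: one-dimensional over [K] and
    fixed by the idempotent. *)
Definition line e (X : lmodType Lambda) (x : X) :=
  [/\ x != 0, pv e *: x = x & forall y, exists c, y = sc c *: x].

Lemma line_simple e X x : @line e X x -> simple_module X.
Proof.
move=> [x0 _ xs]; split=> [h|N].
  by have := h x; rewrite mem_zerom mem_fullm (negPf x0).
have [Nx|Nx] := boolP (x \in N).
  by right=> y; have [c ->] := xs y; rewrite mem_fullm; exact: rpredZ.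
left=> y; rewrite mem_zerom; have [c ->] := xs y.
have [->|c0] := eqVneq c 0; first by rewrite sc0 scale0r eqxx rpred0.
apply/idP/idP=> [Ny|/eqP/sc_scaler_eq0-> //]; last by rewrite sc0 scale0r rpred0.
by case/negP: Nx; rewrite -(scVK x c0); exact: rpredZ.
Qed.

Lemma pv_scaler e e' (U : lmodType Lambda) (x : U) : x = pv e *: x ->
  pv e' *: x = if e' == e then x else 0.
Proof.
by move=> xe; case: eqP => [->//|/eqP ee]; rewrite xe scalerA pv_orth // scale0r.
Qed.

(** The other idempotents annihilate [x]. The scalar and the radical part depend only on [r] and
    [e], not on the module; hence [r] acts by the same scalar on all lines at [e], which makes them
    isomorphic. *)
Lemma scaler_decomp e (r : Lambda) : exists c y, y \in radm Lambda^o 1 /\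
  forall (U : lmodType Lambda) (x : U), x = pv e *: x -> r *: x = sc c *: x + y *: x.
Proof.
have [c [y [hy ->]]] := bound_decomp1 admI r; exists (c e), y; split=> // U x xe.
rewrite scalerDl scaler_suml (bigD1 e) //= big1 ?addr0 => [|e' ee].
  by rewrite -scalerA -xe.
by rewrite -scalerA (pv_scaler _ xe) (negPf ee) scaler0.
Qed.

Lemma line_scaler e r : exists c, forall X x, @line e X x -> r *: x = sc c *: x.
Proof.
have [c [y [hy h]]] := scaler_decomp e r; exists c => X x lx; have [x0 xe xs] := lx.
rewrite (h _ x) // (_ : y *: x = 0) ?addr0 //; move: y hy {h}; apply: radm_ind.
  split=> [|a y z /= hy hz]; first by rewrite /= scale0r.
  by rewrite scalerDl -scalerA hy hz scaler0 addr0.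
move=> a y Ja _; apply: etrans (esym (scalerA _ _ _)) _.
exact: jacobson_simple (line_simple lx) Ja.
Qed.

Lemma line_iso e X x Y y : @line e X x -> @line e Y y -> module_iso X Y.
Proof.
move=> lx ly; have [x0 xe xs] := lx; have [y0 ye ys] := ly.
pose f z := sval (cid (xs z)); have fE z : z = sc (f z) *: x := svalP (cid (xs z)).
pose F z := sc (f z) *: y.
have FE c : F (sc c *: x) = sc c *: y.
  by congr (sc _ *: _); apply: (sc_scaler_inj x0); rewrite -fE.
have linF : linear F.
  move=> r u v; rewrite [u]fE [v]fE !FE; have [c hc] := line_scaler e r.
  by rewrite !sc_scalerC (hc _ _ lx) (hc _ _ ly) !scalerA -scM -!scalerDl -scD FE.
pose h := GRing.isLinear.Build Lambda X Y *:%R F linF.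
exists (HB.pack_for {linear X -> Y} F h);
pose G z := sc (sval (cid (ys z))) *: x.
exists G => [z|z] /=.
  rewrite /G; case: cid => c /= hc; rewrite [RHS]fE; congr (sc _ *: _).
  exact/esym/(sc_scaler_inj y0).
by rewrite /G FE; case: cid.
Qed.

(** A one-dimensional representation at [e] with all arrows zero. It witnesses that the idempotent
    at [e] does not fall into the radical. *)
Definition vertex_rep e : trep K Q :=
  @TRep K Q 0 (fun=> e) (fun=> 0) (fun a i j h => ltac:(by rewrite mxE eqxx in h)).

Lemma vertex_rep_ideal e : {in I, forall z, rho (vertex_rep e) z = 0}.
Proof. by move=> z /admI.1/rho_arrow_power; exact. Qed.

Lemma vertex_rep_line e : line e (const_mx 1 : repmod (vertex_rep_ideal e)).
Proof.
split=> [||y].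
- by apply/eqP=> /matrixP/(_ 0 0)/eqP; rewrite !mxE oner_eq0.
- rewrite repmod_bcls rho_vpath; apply/matrixP=> i j; rewrite mul_diag_mx !mxE.
  by rewrite eqxx mul1r.
exists ((y : 'cV_1) 0 0); apply/matrixP=> i j; rewrite repmod_sc !mxE !ord1 mulr1 //.
Qed.

Lemma vertex_simple_line e : exists x, line e (x : vertex_simple I e).
Proof.
have he : pv e \in span [set pv e : Lambda^o] by exact: mem_span.
pose x : vertex_proj I e := Sub (pv e) he.
pose X : vertex_simple I e := \pi_(quotmod (radm (vertex_proj I e) 1)) x.
exists X; split=> [||y].
- apply/eqP => /quotmod_eq0.
  set k := (const_mx 1 : repmod (vertex_rep_ideal e)).
  have lk := vertex_rep_line e; have [k0 ke _] := lk.
  have [f fx [fZ fD]] : exists2 f : vertex_proj I e -> Lambda, f x = pv e &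
      (forall a u, f (a *: u) = a * f u) /\ {morph f : u v / u + v}.
    pose N := span [set pv e : Lambda^o].
    exists (val : submod N -> Lambda^o); first by [].
    by split=> [a u|u v]; [exact: (@val_submodZ _ _ N a u)|exact: (@val_submodD _ _ N u v)].
  (* If [pv e] lay in the radical of its projective module, it would annihilate the simple module
     spanned by [k], which it fixes. *)
  suff h z : z \in radm (vertex_proj I e) 1 -> f z *: k = 0.
    by move/h; rewrite fx ke => /eqP; rewrite (negPf k0).
  move: z; apply: radm_ind => [|a u Ja _] /=; last first.
    by rewrite fZ -scalerA; exact: jacobson_simple (line_simple lk) Ja.
  split=> [|a u v /= hu hv].
    have -> : f 0 = 0 by rewrite -(scale0r 0) fZ mul0r.
    by rewrite scale0r.
  by rewrite fD fZ scalerDl -scalerA hu hv scaler0 addr0.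
- rewrite -[LHS]pi_quotmod_scale; congr (\pi_(_) _); apply: val_inj.
  by rewrite linearZ /=; exact: pv_idem.
rewrite -[y]reprK; set z := repr y; have /span1P[r zr] := valP z.
have xe : x = pv e *: x by apply: val_inj; rewrite linearZ /=; exact/esym/pv_idem.
have [c [t [ht h]]] := scaler_decomp e r; exists c.
rewrite -[RHS]pi_quotmod_scale; apply/quotmod_eq.
have -> : z = r *: x by apply: val_inj; rewrite linearZ.
rewrite (h _ x xe) addrAC subrr add0r.
exact: (radm_act (i := 0) ht).
Qed.

Lemma subquot_line e (U : lmodType Lambda) (N M : submodClosed U) x :
  x \in N -> x \notin M -> x = pv e *: x ->
  (forall y, y \in N -> exists c, y - sc c *: x \in M) ->
  exists x', line e (x' : subquot N M).
Proof.
move=> Nx Mx xe h; pose y : submod N := Sub x Nx.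
exists (\pi_(quotmod (trace_pred M : submodClosed (submod N))) y); split=> [||z].
- by apply/eqP => /pi_subquot_eq0; rewrite SubK; exact/negP.
- rewrite -[LHS]pi_quotmod_scale; congr (\pi_(_) _); apply: val_inj.
  by rewrite linearZ /= -xe.
rewrite -[z]reprK; have [c hc] := h _ (valP (repr z)); exists c.
rewrite -[RHS]pi_quotmod_scale; apply/quotmod_eq.
by rewrite unfold_in /trace_pred val_submodB val_submodZ.
Qed.

Lemma line_subquot e (U : lmodType Lambda) (N M : submodClosed U)
    (S : lmodType Lambda) (s : S) :
  line e s -> module_iso (subquot N M) S ->
  (forall y, y \in N -> pv e *: y - y \in M) /\ exists2 y, y \in N & y \notin M.
Proof.
move=> [s0 se ss] [f [g fK gK]]; split=> [y Ny|].
  pose z : submod N := Sub y Ny.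
  pose Z : subquot N M := \pi_(quotmod (trace_pred M : submodClosed (submod N))) z.
  have : pv e *: Z = Z.
    apply: (can_inj fK); have -> : f (pv e *: Z) = pv e *: f Z by exact: linearZ.
    by have [c ->] := ss (f Z); rewrite sc_scalerC se.
  rewrite -[LHS]pi_quotmod_scale => /quotmod_eq.
  by rewrite unfold_in /trace_pred val_submodB val_submodZ.
exists (val (repr (g s))); first exact: valP.
apply/negP => /pi_subquot_eq0; rewrite reprK => gs.
by case/eqP: s0; rewrite -[s]gK gs linear0.
Qed.

End Lines.

(** * Uniserial modules and masts *)

Section Masts.
Variables (K : fieldType) (Q : quiver) (I : twoSidedIdeal (path_algebra K Q)).
Hypothesis admI : admissible I.
Local Notation KQ := (path_algebra K Q).
Local Notation Lambda := (bound_algebra I).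
Local Notation J := (jacobson_radical (R := Lambda)).
Local Notation pv e := (pcls I (vpath e)).
Local Notation pa a := (pcls I (apath a)).
Local Notation sc := (sc I).

Lemma pcls_radm p : pcls I p \in radm Lambda^o (plen p).
Proof.
move: {2}(plen p) (erefl (plen p)) => n; elim: n p => [|n IH] p pn; first by rewrite pn.
move: pn; rewrite /plen; case E: (parrows p) => [//|a s] [sn].
have [p' hp' ->] := pcls_cons I E; have := IH p'; rewrite /plen hp' sn => /(_ erefl) h.
have /(radm_act h) : pa a \in radm Lambda^o 1; last by rewrite addn1 /= sn.
rewrite -[pa a]mulr1; apply: (@mem_radm _ Lambda^o 0) => //; exact: (jacobson_pa admI).
Qed.

Section Chain.
Variable U : lmodType Lambda.
Hypothesis chainU : forall N M : submodClosed U, {subset N <= M} \/ {subset M <= N}.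

(* Of x and an element y of another vertex space, one generates the other; so y
   is a multiple of x modulo the radical. *)
Lemma radm_gen i e (x y : U) : x \in radm U i -> x \notin radm U i.+1 ->
  x = pv e *: x -> y \in radm U i -> exists c, y - sc c *: x \in radm U i.+1.
Proof.
move=> Nx JNx xe Ny.
suff h e' : exists c, pv e' *: y - sc c *: x \in radm U i.+1.
  pose c e' := sval (cid (h e')); exists (\sum_e' c e').
  rewrite -[y in y - _]scale1r -(pv_sum I) scaler_suml sc_sum scaler_suml -sumrB.
  by apply: rpred_sum => e' _; exact: svalP (cid (h e')).
set z := pv e' *: y; have Nz : z \in radm U i by exact: rpredZ.
have ze : z = pv e' *: z by rewrite scalerA pv_idem.
have xs : x \in span [set x] by exact: mem_span.
have zs : z \in span [set z] by exact: mem_span.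
have [/(_ x xs)|/(_ z zs)] := chainU (span [set x]) (span [set z]).
  case/span1P=> r xr; have [c [t [ht /(_ _ _ ze) h]]] := scaler_decomp admI e' r.
  have tz : t *: z \in radm U i.+1 by exact: (radm_act ht Nz).
  have xz : x = sc c *: z + t *: z by rewrite -h.
  have c0 : c != 0 by apply: contraNneq JNx => c0; rewrite xz c0 sc0 scale0r add0r.
  exists c^-1; rewrite xz scalerDr scVK // opprD addrA subrr sub0r rpredN.
  exact: rpredZ.
case/span1P=> r zr; have [c [t [ht /(_ _ _ xe) h]]] := scaler_decomp admI e r.
exists c; rewrite zr h addrAC subrr add0r.
exact: (radm_act ht Nx).
Qed.

End Chain.

Section MastBasis.
Variables (U : lmodType Lambda) (p : qpath Q) (e : vertex Q) (x : U).
Local Notation l := (plen p).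
Hypothesis mastU : has_mast U p.
Hypothesis topx : x \notin radm U 1.
Hypothesis xe : x = pv e *: x.

Let chainU : forall N M : submodClosed U, {subset N <= M} \/ {subset M <= N}.
Proof. by case: mastU => -[_]. Qed.

Lemma mast_radm0 (y : U) : y \in radm U l.+1 -> y = 0.
Proof. by case: mastU => _ h _; exact: has_length_radm. Qed.

(** A vector [y] not annihilated by [p] is a multiple of [x] modulo J U, and [p] sends J U into
    J^(l+1) U = 0. *)
Lemma mast_top_neq0 : pcls I p *: x != 0.
Proof.
have [_ _ [y /eqP py]] := mastU.
have [c hc] := radm_gen (i := 0) chainU isT topx xe (y := y) isT.
have /mast_radm0/eqP : pcls I p *: (y - sc c *: x) \in radm U l.+1.
  by rewrite -addn1; exact: (radm_act (pcls_radm p) hc).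
rewrite scalerBr sc_scalerC subr_eq0 => /eqP pyx.
by apply: contraNneq py => px; rewrite pyx px scaler0.
Qed.

Lemma mast_start : e = pstart p.
Proof.
apply/eqP; apply: contraNT mast_top_neq0 => ne.
by rewrite -(pcls_pstart I p) -scalerA (pv_scaler _ xe) [_ == e]eq_sym (negPf ne) scaler0 eqxx.
Qed.

(** The images of [x] under the right subpaths of [p]. They form a [K]-basis of [U] adapted to the
    radical filtration, by [mast_expand] and [mast_free]. *)
Definition mvec j : U := pcls I (ini p j) *: x.

Lemma mvec0 : mvec 0 = x.
Proof.
rewrite /mvec [RHS]xe mast_start; congr (pcls I _ *: _).
by apply: qpath_eq; rewrite // /parrows /= take0.
Qed.

Lemma mvec_pend j : mvec j = pv (pend (ini p j)) *: mvec j.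
Proof. by rewrite /mvec scalerA pcls_pend. Qed.

Lemma plen_ini_le j : (j <= l)%N -> plen (ini p j) = j.
Proof. by move=> jl; rewrite /plen /parrows /= size_takel. Qed.

Lemma mem_mvec j : (j <= l)%N -> mvec j \in radm U j.
Proof.
move=> jl; rewrite -{2}[j](plen_ini_le jl) -[plen _]addn0.
by apply: radm_act => //; exact: pcls_radm.
Qed.

(** Otherwise the rest of [p], applied to [mvec j], would give [p] times [x] inside J^(l+1) U =
    0. *)
Lemma notin_mvec j : (j <= l)%N -> mvec j \notin radm U j.+1.
Proof.
move=> jl; apply: contraTN (mast_top_neq0) => hj; rewrite negbK.
have /right_subpathP[q qp] : right_subpath (ini p j) p.
  by rewrite /right_subpath eqxx /= prefix_take.
have [_ _ pE] := (pcomp_Some _ _ _).1 qp.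
have ql : (plen q + j)%N = l.
  by rewrite /plen pE size_cat -/(plen (ini p j)) plen_ini_le // addnC.
have -> : pcls I p = pcls I q * pcls I (ini p j) by rewrite pclsM qp.
rewrite -scalerA; apply/eqP/mast_radm0; rewrite -ql -addnS.
by apply: radm_act hj; exact: pcls_radm.
Qed.

Lemma mast_expand i y : y \in radm U i -> (i <= l.+1)%N ->
  exists c : nat -> K, y = \sum_(i <= j < l.+1) sc (c j) *: mvec j.
Proof.
move=> hy il; rewrite -(subKn il) in hy *; move: (l.+1 - i)%N (leq_subr i l.+1) hy => k {il}.
elim: k y => [|k IH] y kl; first rewrite subn0.
  by move=> /mast_radm0->; exists (fun=> 0); rewrite big_geq.
rewrite subSS => hy; set m := (l - k)%N; have ml : (m <= l)%N by exact: leq_subr.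
have [c hc] := radm_gen chainU (mem_mvec ml) (notin_mvec ml) (mvec_pend m) hy.
have [||c' E] := IH (y - sc c *: mvec m); [exact: ltnW|by rewrite subSn|].
exists (fun j => if j == m then c else c' j).
rewrite big_ltn ?ltnS // eqxx -[LHS](subrK (sc c *: mvec m)) addrC E subSn //.
congr (_ + _); apply: eq_big_nat => j /andP[mj _].
by rewrite gtn_eqF.
Qed.

(** Once the coefficients before [j] vanish, the relation puts [sc (c j) *: mvec j] into the next
    radical layer. *)
Lemma mast_free (c : nat -> K) : \sum_(0 <= j < l.+1) sc (c j) *: mvec j = 0 ->
  forall j, (j <= l)%N -> c j = 0.
Proof.
move=> h; elim/ltn_ind => j IH jl; apply: contraNeq (notin_mvec jl) => cj.
have cu : sc (c j) *: mvec j \in radm U j.+1.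
  move: h; rewrite (@big_cat_nat _ _ _ j) //=; last exact: leqW.
  rewrite big_nat_cond big1 ?add0r; last first.
    move=> t /andP[/andP[_ tj] _]; rewrite IH ?sc0 ?scale0r //.
    exact: leq_trans (ltnW tj) jl.
  rewrite big_ltn ?ltnS // => /eqP; rewrite addr_eq0 => /eqP->; rewrite rpredN.
  rewrite big_nat_cond; apply: rpred_sum => t /andP[/andP[jt]]; rewrite ltnS => tl _.
  by apply: rpredZ; apply: radm_le jt _ _; exact: mem_mvec.
by rewrite -(scVK (mvec j) cj); exact: rpredZ.
Qed.

Lemma mast_expand_pv i y e' : y \in radm U i -> (i <= l.+1)%N -> y = pv e' *: y ->
  exists c : nat -> K,
    y = \sum_(i <= j < l.+1 | pend (ini p j) == e') sc (c j) *: mvec j.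
Proof.
move=> hy il ->; have [c {1}->] := mast_expand hy il; exists c.
rewrite scaler_sumr [RHS]big_mkcond; apply: eq_bigr => j _ /=.
rewrite sc_scalerC (pv_scaler _ (mvec_pend j)) eq_sym.
by case: eqP; rewrite ?scaler0.
Qed.

Lemma mast_line i : (i <= l)%N ->
  exists x', line (pend (ini p i)) (x' : subquot (radm U i) (radm U i.+1)).
Proof.
move=> il; apply: subquot_line (mem_mvec il) (notin_mvec il) (mvec_pend i) _.
by move=> y hy; apply: radm_gen hy => //; [exact: mem_mvec|exact: notin_mvec|exact: mvec_pend].
Qed.

End MastBasis.

(* A uniserial module whose layers are the simples at the vertices of [p] has
   mast [p], as each step of [p] is the only arrow between its endpoints. *)
Section SeriesMast.
Variables (U : lmodType Lambda) (p : qpath Q).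
Local Notation l := (plen p).
Hypothesis unserU : uniserial U.
Hypothesis lenU : has_length U l.+1.
Variables (S : nat -> lmodType Lambda) (s : forall i, S i).
Hypothesis lineS : forall i, line (pend (ini p i)) (s i).
Hypothesis isoS : forall i, (i <= l)%N ->
  module_iso (subquot (radm U i) (radm U i.+1)) (S i).
Hypothesis uniq_arrow : forall i a, (i < l)%N ->
  src a = pend (ini p i) -> tgt a = pend (ini p i.+1) ->
  pcomp (apath a) (ini p i) = Some (ini p i.+1).

Lemma series_mast : has_mast U p /\
  exists x : U, x \notin radm U 1 /\ x = pv (pstart p) *: x.
Proof.
have chainU := unserU.2.
have ini0 : ini p 0 = vpath (pstart p) by apply: plen0; rewrite /plen /parrows /= take0.
have [x [x1 xe]] : exists x : U, x \notin radm U 1 /\ x = pv (pstart p) *: x.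
  have [h [y _ y1]] := line_subquot (lineS 0) (isoS (leq0n l)).
  exists (pv (pstart p) *: y); split; last by rewrite scalerA pv_idem.
  apply: contra y1 => y1; rewrite -[y](subKr (pv (pstart p) *: y)); apply: rpredB => //.
  by have := h y isT; rewrite ini0.
split; last by exists x.
pose u i : U := pcls I (ini p i) *: x.
suff hu i : (i <= l)%N -> u i \in radm U i /\ u i \notin radm U i.+1.
  split=> //; exists x => px; have [_] := hu l (leqnn l).
  rewrite /u (_ : ini p l = p) ?px ?rpred0 //.
  by apply: qpath_eq; rewrite // /parrows /= take_size.
elim: i => [_|i IH il].
  by rewrite /u ini0 -xe.
have [ui uI] := IH (ltnW il); set e := pend (ini p i) in uI.
have ue : u i = pv e *: u i by rewrite /u scalerA pcls_pend.
split.
  by have := radm_act (i := 0) (u := x) (pcls_radm (ini p i.+1)) isT;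
    rewrite addn0 plen_ini_le.
set e' := pend (ini p i.+1).
have [h [y yi]] := line_subquot (lineS i.+1) (isoS il).
(* If [u i.+1] fell into J^(i+2) U, so would every generator a w of J^(i+1) U, with a in J and w in
   J^i U, against the choice of [y]. Modulo J^(i+1) U, w is a multiple of [u i], so only a u_i
   matters. *)
apply: contraNN => uS.
move: y yi; apply: radm_ind => [|a w Ja wi] /=; first exact: lin_closed_mem.
have aw : a *: w \in radm U i.+1 by exact: mem_radm.
have [c hc] := radm_gen chainU ui uI ue wi.
have ah : a *: w - sc c *: (a *: u i) \in radm U i.+2.
  by rewrite -sc_scalerC -scalerBr; exact: mem_radm.
have au : a *: u i \in radm U i.+1 by exact: mem_radm.
suff aus : a *: u i \in radm U i.+2.
  by rewrite -(subrK (sc c *: (a *: u i)) (a *: w)); apply: rpredD => //; exact: rpredZ.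
rewrite -[_ *: _](subKr (pv e' *: (a *: u i))); apply: rpredB; last exact: h.
have [d [f [t [ht aE]]]] := bound_decomp admI a.
have tu : t *: u i \in radm U i.+2 by exact: radm_act ht ui.
have aui : a *: u i = sc (d e) *: u i + (\sum_b sc (f b) *: (pa b *: u i) + t *: u i).
  rewrite {1}aE !scalerDl !scaler_suml (bigD1 e) //= big1 ?addr0 -?scalerA -?ue.
    by rewrite addrA; congr (_ + _ + _); apply: eq_bigr => b _; rewrite scalerA.
  by move=> v ve; rewrite -scalerA (pv_scaler _ ue) (negPf ve) scaler0.
have bu b : pa b *: u i \in radm U i.+1 by apply: mem_radm => //; exact: (jacobson_pa admI).
(* All other terms of a u_i lie in J^(i+1) U, and [u i] does not. *)
have de : d e = 0.
  apply: contraNeq uI => de; rewrite -(scVK (u i) de); apply: rpredZ.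
  have -> : sc (d e) *: u i = a *: u i - (\sum_b sc (f b) *: (pa b *: u i) + t *: u i).
    by rewrite aui addrK.
  apply: rpredB => //; apply: rpredD; last exact: radm_le (leqnSn _) _ tu.
  by apply: rpred_sum => b _; exact: rpredZ.
rewrite aui de sc0 scale0r add0r scalerDr scaler_sumr; apply: rpredD; last exact: rpredZ.
apply: rpred_sum => b _; rewrite sc_scalerC; apply: rpredZ.
(* Only an arrow from [e] to [e'] can contribute, and by [uniq_arrow] it carries [u i] to
   [u i.+1]. *)
have [be|be] := eqVneq (src b) e; last first.
  by rewrite -(pa_src I) -scalerA (pv_scaler _ ue) (negPf be) !scaler0 rpred0.
have [be'|be'] := eqVneq (tgt b) e'; last first.
  by rewrite -(pa_tgt I) -scalerA [_ *: (_ *: _)]scalerA pv_orth 1?eq_sym // scale0r rpred0.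
apply: rpredZ; rewrite /u scalerA pclsM.
by rewrite (uniq_arrow il be be').
Qed.

End SeriesMast.

End Masts.

(** * The gadget quiver *)

Section ArrowPowers.
Variables (K : fieldType) (Q : quiver).
Local Notation KQ := (path_algebra K Q).

Lemma arrow_ideal_apath a : pvec (apath a) \in arrow_ideal K Q.
Proof. by apply/asboolP => T; apply; exists a. Qed.

Lemma arrow_power_mulr m x y :
  x \in arrow_power K Q m -> x * y \in arrow_power K Q m.
Proof.
move=> hx; have := @powm_act KQ _ KQ^o m 0 x y hx isT; by rewrite addn0.
Qed.

Lemma arrow_power_pvec p : pvec p \in arrow_power K Q (plen p).
Proof.
rewrite /plen; move: {2}(parrows p) (erefl (parrows p)) => s.
elim: s p => [|a s IH] p ps; first by rewrite ps.
have [p' [h1 h2 h3]] := parrows_cons ps.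
have -> : pvec p = pvec p' * pvec (apath a) :> KQ by rewrite pvecM h2.
rewrite (_ : size _ = size (parrows p') + 1)%N; last by rewrite ps h1 addn1.
apply: (@powm_act _ _ KQ^o); first exact: IH.
rewrite -[pvec (apath a)]mulr1.
exact: (@mem_smulm _ KQ^o _ _ _ 1 (arrow_ideal_apath a)).
Qed.

End ArrowPowers.

Section GadgetQuiver.
Local Open Scope nat_scope.
Variable n : nat.

(** Three arrows for each of the [n.+1] gadgets, written as a successor so that [inord] produces
    arrows. *)
Definition glen := (3 * n)%N.+3.
Lemma glenE : glen = 3 * n.+1. Proof. by rewrite mulnS. Qed.
(* Position t on the mast lies at the vertex gpos t, and arrow t leads from
   position t to position t + 1.  The positions 3 * i + 1 and 3 * i + 2 share a
   vertex, so that arrow 3 * i + 1 is the loop of gadget i. *)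
Definition gpos (t : nat) : nat := (t - t.+1 %/ 3)%N.

(** Position 3 * i lies at vertex 2 * i, and the gadget i at vertex 2 * i + 1; the last position has
    number 2 * n + 2. *)
Definition gvert (t : nat) : 'I_(2 * n)%N.+3 := inord (gpos t).
Definition gquiver : quiver :=
  @Quiver 'I_(2 * n)%N.+3 'I_glen (fun a => gvert a) (fun a => gvert a.+1).
Local Notation Q := gquiver.
Definition garrow (t : nat) : arrow Q := inord t.

Lemma val_gvert t : (t <= glen)%N -> gvert t = gpos t :> nat.
Proof. by move=> h; rewrite inordK //; move: h; rewrite /gpos /glen; lia. Qed.

Lemma gvert_eq s t : (s <= glen)%N -> (t <= glen)%N ->
  gvert s = gvert t -> gpos s = gpos t.
Proof. by move=> hs ht /(congr1 val) /=; rewrite !val_gvert. Qed.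

Lemma eq_gvert s t : gpos s = gpos t -> gvert s = gvert t.
Proof. by rewrite /gvert => ->. Qed.

Lemma val_garrow t : (t < glen)%N -> garrow t = t :> nat.
Proof. by move=> h; rewrite inordK. Qed.

Lemma garrow_val (a : arrow Q) : garrow a = a.
Proof. exact: inord_val. Qed.

Lemma src_garrow t : (t < glen)%N -> src (garrow t) = gvert t.
Proof. by move=> h; rewrite /= val_garrow. Qed.

Lemma tgt_garrow t : (t < glen)%N -> tgt (garrow t) = gvert t.+1.
Proof. by move=> h; rewrite /= val_garrow. Qed.

Lemma gchain_le (v : vertex Q) s : chain v s -> (v <= last v (map tgt s))%N.
Proof.
elim: s v => //= a s IH v /andP[/eqP <- /IH]; apply: leq_trans.
have ha := ltn_ord a; rewrite /= (val_gvert (ltnW ha)) (val_gvert ha) /gpos; lia.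
Qed.

(** By the residue of [a] modulo 3. Residue 2, the exit of a gadget: the only arrow into its end, so
    a parallel path ends with it. Residue 0, the entry: the only arrow out of its start. Residue 1,
    the loop: a closed path cannot leave the gadget. *)
Lemma gcondition_N (K : fieldType) (I : twoSidedIdeal (path_algebra K Q)) :
  condition_N I.
Proof.
move=> a p _; rewrite /plen; have [av|av] := eqVneq (a %% 3)%N 2.
  case/lastP E: (parrows p) => [//|s b] _ _.
  rewrite /pend E map_rcons last_rcons => ba; right.
  have {}ba : b = a.
    apply: ord_inj; have := ltn_ord a; have := ltn_ord b; move=> hb ha.
    by move: (gvert_eq hb ha ba); rewrite /gpos; lia.
  have cs : chain (pstart p) s.
    by have := pdataP p; rewrite -/(parrows p) -/(pstart p) E -cats1 chain_cat => /andP[].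
  exists (pvec (@QPath Q (pstart p, s) cs)); rewrite pvecM.
  rewrite (_ : pcomp _ _ = Some p) //; apply/pcomp_Some; split=> //.
    have := pdataP p; rewrite -/(parrows p) -/(pstart p) E -cats1 chain_cat /=.
    by rewrite andbT ba => /andP[_ /eqP/esym].
  by rewrite /= E -cats1 ba.
case E: (parrows p) => [//|b s] _ pb.
have pE := pdataP p; rewrite -/(parrows p) -/(pstart p) E /= in pE.
have /andP[/eqP bp bs] := pE.
have start : b = a -> exists z, pvec p = (z * pvec (apath a))%R :> path_algebra K Q.
  by move=> <-; have [p' [_ h _]] := parrows_cons E; exists (pvec p'); rewrite pvecM h.
have hb := ltn_ord b; have ha := ltn_ord a.
have [ba|ba] := eqVneq b a; first by move=> _; left; exact: start.
have gab : gpos b = gpos a.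
  by apply: (gvert_eq (ltnW hb) (ltnW ha) (etrans bp pb)).
(* Two different arrows with a common start are the loop and the exit of a gadget, and [a] is not an
   exit. *)
have a1 : a %% 3 = 1.
  have : (b : nat) != a by apply: contra ba => /eqP/ord_inj->.
  by move: gab av; rewrite /gpos; lia.
move: E bs {pE}; case/lastP: s => [|s' c] E.
  move=> _; rewrite /pend E /= => /(gvert_eq hb ha); move: ba; rewrite -val_eqE /=.
  by move: gab a1; rewrite /gpos; lia.
rewrite -cats1 chain_cat /= => /and3P[cs' /eqP cl _].
rewrite /pend E map_cons map_rcons last_cons last_rcons => ca.
have hc := ltn_ord c.
have [{}ca|cna] := eqVneq c a.
  right; have cbs : chain (pstart p) (b :: s').
    by rewrite /= bp eqxx.
  exists (pvec (@QPath Q (pstart p, b :: s') cbs)); rewrite pvecM.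
  rewrite (_ : pcomp _ _ = Some p) //; apply/pcomp_Some; split=> //.
    by rewrite -ca; exact: (esym cl).
  by rewrite /= E -cats1 ca.
(* Here [b] is the exit of the gadget and [c] its entry, whose start has a smaller number than the
   end of [b]. *)
have := gchain_le cs'; rewrite -cl /= (val_gvert hb) (val_gvert (ltnW hc)).
move: (gvert_eq hc ha ca) gab a1 ba cna; rewrite -!val_eqE /= /gpos; lia.
Qed.

(* The gadgets in [T] are crossed without their loops. *)
Fixpoint gword (T : pred nat) i : seq nat :=
  if i is i'.+1 then
    gword T i' ++ (if T i' then [:: 3 * i'; (3 * i').+2] else iota (3 * i') 3)
  else [::].

Lemma gword_pred0 i : gword pred0 i = iota 0 (3 * i).
Proof.
elim: i => // i IH.
by rewrite (_ : gword pred0 i.+1 = gword pred0 i ++ iota (3 * i) 3) // IH mulnS addnC iotaD.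
Qed.

Lemma ggadget_chain T i m : m = 3 * i -> i < n.+1 ->
  let s := if T i then [:: m; m.+2] else iota m 3 in
  chain (gvert m : vertex Q) (map garrow s) /\
  last (gvert m) (map tgt (map garrow s)) = gvert m.+3.
Proof.
move=> mi hi /=; have [m0 m1 m2] : [/\ m < glen, m.+1 < glen & m.+2 < glen].
  by rewrite /glen; split; lia.
have e12 : gvert m.+2 = gvert m.+1 by apply: eq_gvert; rewrite /gpos; lia.
by case: (T i); rewrite /= !val_garrow // !eqxx /= ?e12 ?eqxx.
Qed.

Lemma gword_chain T i : i <= n.+1 ->
  chain (gvert 0 : vertex Q) (map garrow (gword T i)) /\
  last (gvert 0) (map tgt (map garrow (gword T i))) = gvert (3 * i).
Proof.
elim: i => [|i IH] hi; first by rewrite muln0.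
have [IH1 IH2] := IH (ltnW hi).
have [h1 h2] := @ggadget_chain T i _ erefl hi.
rewrite [gword _ _]/= !map_cat chain_cat last_cat IH1 IH2; split; first exact: h1.
by rewrite -[RHS]/(gvert (3 * i.+1)) mulnS; exact: h2.
Qed.

Definition gpath T : qpath Q := @QPath Q (gvert 0, map garrow (gword T n.+1))
  (gword_chain T (leqnn n.+1)).1.

Definition gmast := gpath pred0.
Local Notation p := gmast.

Lemma parrows_gmast : parrows p = map garrow (iota 0 glen).
Proof.
by rewrite -[LHS]/(map garrow (gword pred0 n.+1)) gword_pred0 glenE.
Qed.

Lemma plen_gmast : plen p = glen.
Proof. by rewrite /plen parrows_gmast size_map size_iota. Qed.

Lemma gmast_nth b j : j < glen -> nth b (parrows p) j = garrow j.
Proof.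
by move=> hj; rewrite parrows_gmast (nth_map 0) ?size_iota // nth_iota.
Qed.

Lemma pend_ini_gmast j : j <= glen -> pend (ini p j) = gvert j.
Proof.
rewrite /pend -[parrows (ini p j)]/(take j (parrows p)); elim: j => [|j IH] hj.
  by rewrite take0.
rewrite (take_nth (garrow 0)) ?gmast_nth //; last first.
  by rewrite parrows_gmast size_map size_iota.
by rewrite map_rcons last_rcons tgt_garrow.
Qed.

Lemma ini_gmastS j : j < glen -> pcomp (apath (garrow j)) (ini p j) = Some (ini p j.+1).
Proof.
move=> hj; apply/pcomp_Some; split=> //.
  by rewrite pend_ini_gmast ?(ltnW hj) //; exact/esym/src_garrow.
rewrite [LHS](_ : _ = take j.+1 (parrows p)) // (take_nth (garrow 0)) ?gmast_nth //.
  by rewrite -cats1.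
by rewrite parrows_gmast size_map size_iota.
Qed.

(** The last gadget alone contributes two arrows, even without its loop. This places the relations
    of [gideal_relation] in the square of the arrow ideal. *)
Lemma gpath_long T : 2 <= plen (gpath T).
Proof.
rewrite /plen /parrows /= size_map size_cat; case: (T n) => /=; lia.
Qed.

Lemma gmast_step j (a : arrow Q) : j < glen -> src a = gvert j -> tgt a = gvert j.+1 ->
  a = garrow j.
Proof.
move=> hj sa ta; have ha := ltn_ord a; apply: ord_inj; rewrite val_garrow //.
move: (gvert_eq (ltnW ha) (ltnW hj) sa) (gvert_eq ha hj ta); rewrite /gpos; lia.
Qed.

(** Before its loop, at position 3 * i + 1, a gadget can be left at once, which reaches the vertex
    of position 3 * i + 3. Repeating the loop at position 3 * i + 2 is no detour: no longer right
    subpath ends at that vertex. *)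
Lemma gmast_detour (a : arrow Q) j m : j <= glen -> m <= glen ->
  detour p a (ini p j) -> j < m -> pend (ini p m) = tgt a ->
  [/\ j %% 3 = 1, j < glen, a = garrow j.+1 & m = j.+2].
Proof.
move=> hj hm /and3P[_ + _] jm; case E: (pcomp _ _) => [au|//].
have [ea _ _] := (pcomp_Some _ _ _).1 E.
rewrite pend_ini_gmast // => aup ma.
rewrite pend_ini_gmast // in ea.
have ha := ltn_ord a.
have g1 := gvert_eq hj (ltnW ha) ea.
have g2 := gvert_eq hm ha ma.
have aj : (a : nat) <> j.
  move=> aj; move: aup E; rewrite -(garrow_val a) aj.
  have jg : j < glen by rewrite -aj.
  rewrite ini_gmastS // => /negP aup [aue]; apply: aup.
  by rewrite -aue /right_subpath eqxx /= prefix_take.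
have h : [/\ j %% 3 = 1, (a : nat) = j.+1 & m = j.+2].
  by move: g1 g2 aj jm; rewrite /gpos; split; lia.
have [h1 h2 h3] := h; split=> //; first by rewrite -h2 in ha *; lia.
by rewrite -(garrow_val a) h2.
Qed.

Lemma gmast_detourP j : j < glen -> j %% 3 = 1 -> detour p (garrow j.+1) (ini p j).
Proof.
move=> hj j1; have hj1 : j.+1 < glen by rewrite glenE in hj *; lia.
have hj2 : j.+2 <= glen by [].
apply/and3P; split; first by rewrite /right_subpath eqxx /= prefix_take.
  case E: (pcomp _ _) => [au|]; last first.
    move/pcomp_None: E; rewrite pend_ini_gmast ?(ltnW hj) // [pstart _]src_garrow //.
    by case; apply: eq_gvert; rewrite /gpos; lia.
  have [_ _ ea] := (pcomp_Some _ _ _).1 E; apply/negP => /andP[_].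
  rewrite prefixE ea => /eqP/(congr1 (nth (garrow 0)^~ j)).
  have sj : size (parrows (ini p j)) = j.
    by rewrite [parrows _](_ : _ = take j (parrows p)) // size_takel // [size _]plen_gmast ltnW.
  rewrite nth_cat sj ltnn subnn nth_take ?size_cat ?sj ?addn1 // gmast_nth //.
  move/(congr1 val); rewrite [RHS]val_garrow // [LHS]val_garrow //; lia.
have hp : j.+2 < (plen p).+1 by rewrite plen_gmast ltnS.
apply/existsP; exists (Ordinal hp); apply/andP; split; last first.
  by apply/eqP/(etrans (pend_ini_gmast hj2))/esym/tgt_garrow.
rewrite /plen [parrows _](_ : _ = take j (parrows p)) // size_takel; first exact: ltnW.
by rewrite [size _]plen_gmast ltnW.
Qed.

End GadgetQuiver.

Section WordEvaluation.
Variables (R : pzRingType) (X : lmodType R) (a k : nat -> R) (x : nat -> X).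
Hypothesis ka : forall j t, GRing.comm (a t) (k j).

(** Skipping the loop of gadget j costs the factor [k j]. The abstract setting covers both the
    matrices of [grep] and an arbitrary uniserial module. *)
Lemma gword_eval T i :
  (forall t, (t < 3 * i)%N -> a t *: x t = x t.+1) ->
  (forall j, (j < i)%N -> a (3 * j).+2 *: x (3 * j).+1 = k j *: x (3 * j).+3) ->
  (\prod_(t <- rev (gword T i)) a t) *: x 0%N =
  (\prod_(0 <= j < i) (if T j then k j else 1)) *: x (3 * i)%N.
Proof.
elim: i => [|i IH] step skip; first by rewrite big_nil big_geq.
have {}IH : (\prod_(t <- rev (gword T i)) a t) *: x 0%N =
  (\prod_(0 <= j < i) (if T j then k j else 1)) *: x (3 * i)%N.
  apply: IH => [t ti|j ji]; [apply: step|apply: skip]; last exact: ltnW.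
  by apply: leq_trans ti _; rewrite leq_mul2l leqnSn.
have e3 : (3 * i.+1 = (3 * i).+3)%N by rewrite mulnS.
have [s0 s1 s2] : [/\ 3 * i < 3 * i.+1, (3 * i).+1 < 3 * i.+1
  & (3 * i).+2 < 3 * i.+1]%N by rewrite e3; split; lia.
have := step _ s0; have := step _ s1; have := step _ s2; have := skip _ (ltnSn i).
rewrite [gword _ _]/= rev_cat big_cat -scalerA IH big_nat_recr // e3.
have cP t v : a t *: ((\prod_(0 <= j < i) if T j then k j else 1) *: v) =
    (\prod_(0 <= j < i) if T j then k j else 1) *: (a t *: v) :> X.
  rewrite !scalerA; congr (_ *: _); apply: commr_prod => j _; case: ifP => _ //.
  exact: commr1.
move: (\prod_(0 <= j < i) _) (3 * i)%N cP => P m cP h h2 h1 h0 /=.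
rewrite -[RHS]scalerA; case: (T i); rewrite /rev /= !big_cons big_nil mulr1 -!scalerA.
  by rewrite !cP h0 h.
by rewrite !cP h0 h1 h2 scale1r.
Qed.

End WordEvaluation.

(** * The representations attached to points, and their annihilator *)

Section GadgetAlgebra.
Variables (K : fieldType) (n : nat).
Local Notation Q := (gquiver n).
Local Notation KQ := (path_algebra K Q).
Local Notation L := (glen n).
Implicit Types (kappa : {ffun 'I_n.+1 -> K}) (A : {set 'I_n.+1}).

(** Arrow s sends basis vector t to this multiple of basis vector s + 1: 1 along the mast, the
    parameter of the gadget for an exit taken before the loop, 0 otherwise. *)
Definition gcoef kappa (s t : nat) : K :=
  (t == s)%:R + ((s %% 3 == 2) && (t.+1 == s))%N%:R * kappa (inord (s %/ 3)).

Definition garr kappa (a : arrow Q) : 'M[K]_L.+1 :=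
  \matrix_(i, j) ((i == a.+1 :> nat)%:R * gcoef kappa a j).

Lemma garrP kappa a i j : garr kappa a i j != 0 ->
  [/\ gvert n i = tgt a, gvert n j = src a & (j < i)%N].
Proof.
rewrite mxE mulf_eq0 negb_or; case: (eqVneq (i : nat) a.+1) => [ia|_]; last by rewrite eqxx.
move=> /andP[_]; rewrite ia /gcoef; have [ja _|ja] := eqVneq (j : nat) a.
  by rewrite ja; split.
rewrite add0r; case: (boolP (_ && _)) => [/andP[/eqP a2 /eqP ja1] _|]; last first.
  by rewrite mul0r eqxx.
split=> //=; last by rewrite -ja1 ltnW.
by apply: eq_gvert; move: a2; rewrite -ja1 /gpos; lia.
Qed.

Definition grep kappa : trep K Q := @TRep K Q L (fun i => gvert n i) (garr kappa)
  (@garrP kappa).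

(** Carries basis vector 0 to basis vector t. It is square, so that [gword_eval] applies to the left
    regular module of the matrix ring. *)
Definition gunit (t : nat) : 'M[K]_L.+1 := delta_mx (inord t) 0.

Lemma garr_unit kappa s t : (s < L)%N -> (t <= L)%N ->
  garr kappa (garrow n s) *m gunit t = gcoef kappa s t *: gunit s.+1.
Proof.
move=> hs ht; apply/matrixP=> i j; rewrite !mxE (bigD1 (inord t)) //= !mxE eqxx /=.
rewrite big1 ?addr0 => [|m /negPf mt]; last by rewrite !mxE mt mulr0.
rewrite val_garrow // inordK // mulrAC mulrC; congr (_ * _).
by rewrite -natrM mulnb -[i == inord _](inj_eq val_inj) /= inordK.
Qed.

Definition gmono kappa A : K := \prod_(i in A) kappa i.

Definition gskip A : pred nat := fun j => inord j \in A.

Lemma gmonoE kappa A :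
  \prod_(0 <= j < n.+1) (if gskip A j then kappa (inord j) else 1) = gmono kappa A.
Proof.
rewrite big_mkord /gmono [RHS]big_mkcond; apply: eq_bigr => i _.
by rewrite /gskip inord_val.
Qed.

Lemma gcoef_diag kappa t : gcoef kappa t t = 1.
Proof. by rewrite /gcoef eqxx (_ : (t.+1 == t) = false) ?andbF ?mul0r ?addr0 //; lia. Qed.

Lemma gcoef_skip kappa j : gcoef kappa (3 * j).+2 (3 * j).+1 = kappa (inord j).
Proof.
rewrite /gcoef; have -> : ((3 * j).+1 == (3 * j).+2)%N = false by lia.
have -> : ((3 * j).+2 %% 3 == 2)%N by lia.
by rewrite eqxx add0r mul1r; congr (kappa (inord _)); lia.
Qed.

Lemma rho_gpath kappa A :
  rho (grep kappa) (pvec (gpath n (gskip A))) = gmono kappa A *: gunit L.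
Proof.
rewrite rho_pvec /rpath.
(* The start vertex occurs at position 0 only, so its projection is an elementary matrix. *)
have -> : rproj (grep kappa) (pstart (gpath n (gskip A))) = gunit 0 :> 'M[K]_L.+1.
  apply/matrixP=> i j; rewrite /gunit !mxE.
  have -> : (inord 0 : 'I_L.+1) = 0 by apply: val_inj; rewrite /= inordK.
  have [<-|ij] := eqVneq i j; last first.
    by rewrite mulr0n; case: (eqVneq i 0) => [i0|//]; rewrite -i0 eq_sym (negPf ij).
  rewrite andbb mulr1n; congr (_%:R); congr nat_of_bool; apply/eqP/eqP=> [|->] //.
  have hi : (i <= L)%N by have := ltn_ord i.
  move/(gvert_eq hi (leq0n _)); rewrite /gpos => h; apply: ord_inj; rewrite [RHS]/=; lia.
rewrite -[parrows _]/(map (garrow n) (gword (gskip A) n.+1)) -map_rev big_map.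
have := @gword_eval _ ('M[K]_L.+1)^o (fun t => garr kappa (garrow n t))
  (fun j => (kappa (inord j))%:M) gunit _ (gskip A) n.+1.
rewrite -glenE => E; apply: etrans (E _ _ _) _ => {E} [j t|t tL|j jn|].
- exact: scalar_mxC.
- rewrite -[LHS]/(_ *m _) garr_unit ?gcoef_diag ?scale1r //; exact: ltnW.
- rewrite -[LHS]/(_ *m _) -[RHS]/(_ *m _) garr_unit ?gcoef_skip ?mul_scalar_mx //;
    rewrite glenE; lia.
have -> : \prod_(0 <= j < n.+1) (if gskip A j then (kappa (inord j))%:M else 1) =
    (gmono kappa A)%:M :> 'M[K]_L.+1.
  rewrite -gmonoE (big_morph (fun c : K => c%:M : 'M_L.+1) (@scalar_mxM _ _) erefl).
  by apply: eq_bigr => j _; case: ifP.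
exact: mul_scalar_mx.
Qed.

Section GadgetIdeal.
Variable W : set {ffun 'I_n.+1 -> K}.

Definition gideal_pred : {pred KQ} := fun z =>
  `[< z \in arrow_power K Q 2 /\ forall kappa, W kappa -> rho (grep kappa) z = 0 >].
Lemma gideal_zmod : zmod_closed gideal_pred.
Proof.
split=> [|x y /asboolP[hx kx] /asboolP[hy ky]]; apply/asboolP.
  by split=> [|kappa _]; [exact: rpred0|exact: linear0].
split=> [|kappa Wk]; first exact: rpredB.
by rewrite linearB /= kx // ky // subrr.
Qed.
HB.instance Definition _ := GRing.isZmodClosed.Build KQ gideal_pred gideal_zmod.
Lemma gidealMl a x : x \in gideal_pred -> a * x \in gideal_pred.
Proof.
move=> /asboolP[hx kx]; apply/asboolP; split=> [|kappa Wk].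
  exact: (@rpredZ _ KQ^o (arrow_power K Q 2) a).
by rewrite rhoM kx ?mulr0.
Qed.
Lemma gidealMr a x : x \in gideal_pred -> x * a \in gideal_pred.
Proof.
move=> /asboolP[hx kx]; apply/asboolP; split=> [|kappa Wk].
  exact: arrow_power_mulr.
by rewrite rhoM kx ?mul0r.
Qed.
HB.instance Definition _ := isTwoSided.Build KQ gideal_pred gidealMl gidealMr.
Definition gideal : twoSidedIdeal KQ := gideal_pred.

Lemma gideal_rho kappa : W kappa -> {in gideal, forall z, rho (grep kappa) z = 0}.
Proof. by move=> Wk z /asboolP[_]; exact. Qed.

Lemma gideal_admissible : admissible gideal.
Proof.
(* The representations have dimension [L.+1], so no product of [L.+1] arrows survives. *)
split=> [z /asboolP[]//|]; exists L.+1; split=> // z hz; apply/asboolP; split.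
  exact: powm_le hz.
by move=> kappa _; exact: rho_arrow_power hz.
Qed.

(** This is how a multilinear equation of [W] becomes a relation of the algebra. *)
Lemma gideal_relation (c : {set 'I_n.+1} -> K) :
  (forall kappa, W kappa -> \sum_A c A * gmono kappa A = 0) ->
  \sum_A c A *: pvec (gpath n (gskip A)) \in gideal.
Proof.
move=> hc; apply/asboolP; split.
  apply: rpred_sum => A _; rewrite -[pvec _]mul1r path_algebra_scaleAl.
  apply: (@rpredZ _ KQ^o (arrow_power K Q 2) (c A *: (1 : KQ))).
  exact: powm_le (gpath_long _ _) _ (arrow_power_pvec _ _).
move=> kappa Wk; rewrite linear_sum /=.
under eq_bigr => A _ do rewrite linearZ /= rho_gpath scalerA.
by rewrite -scaler_suml hc // scale0r.
Qed.

End GadgetIdeal.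

End GadgetAlgebra.

(** * Uniserial modules over the gadget algebra *)

Section GadgetModule.
Variables (K : fieldType) (n : nat) (W : set {ffun 'I_n.+1 -> K}).
Variables (kappa : {ffun 'I_n.+1 -> K}) (Wk : W kappa).
Local Notation Q := (gquiver n).
Local Notation L := (glen n).
Local Notation I := (gideal W).
Local Notation Lambda := (bound_algebra I).
Local Notation pv e := (pcls I (@vpath Q e)).
Local Notation pa a := (pcls I (apath a)).
Local Notation sc := (sc I).
Local Notation p := (gmast n).

Definition gmod : lmodType Lambda := repmod (gideal_rho Wk).

Definition coord (y : gmod) (t : nat) : K := (y : 'cV[K]_L.+1) (inord t) 0.

Definition gbase (t : nat) : gmod := (delta_mx (inord t) 0 : 'cV[K]_L.+1).

Lemma coordP (y z : gmod) : (forall t, (t <= L)%N -> coord y t = coord z t) -> y = z.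
Proof.
move=> h; apply/matrixP=> i j; rewrite !ord1.
by have := h i (ltnSE (ltn_ord i)); rewrite /coord inord_val.
Qed.

Lemma coordD y z t : coord (y + z) t = coord y t + coord z t.
Proof. exact: mxE. Qed.
Lemma coordB y z t : coord (y - z) t = coord y t - coord z t.
Proof. by rewrite /coord !mxE. Qed.
Lemma coord_sc c y t : coord (sc c *: y) t = c * coord y t.
Proof. by rewrite /coord repmod_sc mxE. Qed.
Lemma coord0 t : coord 0 t = 0. Proof. exact: mxE. Qed.

Lemma coord_base s t : (s <= L)%N -> (t <= L)%N -> coord (gbase s) t = (t == s)%:R.
Proof.
move=> hs ht; rewrite /coord mxE eqxx andbT; congr (nat_of_bool _)%:R.
by rewrite -(inj_eq val_inj) /= !inordK.
Qed.

Lemma coord_ord (y : gmod) (i : 'I_L.+1) : coord y i = (y : 'cV[K]_L.+1) i 0.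
Proof. by rewrite /coord inord_val. Qed.

(** The parameter in arrow s multiplies only the coordinate s - 1, which vanishes here; so on
    leading coefficients the arrow acts as along the mast. *)
Lemma coord_pa s y t : (s < L)%N -> (t <= L)%N ->
  (forall u, (u < s)%N -> coord y u = 0) ->
  coord (pa (garrow n s) *: y) t = (t == s.+1)%:R * coord y s.
Proof.
move=> hs ht y0; rewrite /coord [_ *: _]repmod_bcls rho_apath mxE.
rewrite (bigD1 (inord s)) //= big1 ?addr0 => [|i ns]; rewrite !mxE val_garrow //.
  by rewrite inordK // inordK ?gcoef_diag ?mulr1 // leqW.
have {}ns : (i : nat) != s by apply: contra ns => /eqP<-; rewrite inord_val.
rewrite /gcoef (negPf ns) add0r; have [e|_] := eqVneq i.+1 s.
  by rewrite -coord_ord y0 ?mulr0 // -e.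
by rewrite andbF mul0r mulr0 mul0r.
Qed.

Lemma gbase_pv t : (t <= L)%N -> gbase t = pv (gvert n t) *: gbase t.
Proof.
move=> ht; apply: esym; rewrite [LHS]repmod_bcls rho_vpath mul_diag_mx.
apply/matrixP=> i j; rewrite !mxE; case: (eqVneq i (inord t)) => [->|_]; last exact: mulr0.
by rewrite /= inordK // eqxx mul1r.
Qed.

Definition vanish i : set gmod :=
  [set y | forall t, (t < i)%N -> (t <= L)%N -> coord y t = 0].

Lemma vanish_closed i : lin_closed (vanish i).
Proof.
split=> [t _ _|a y z hy hz t ti tL]; first exact: coord0.
rewrite coordD hz // addr0 /coord -[a]bclsK [_ *: _]repmod_bcls mxE big1 // => j _.
have [tj|jt] := ltnP t j.
  by rewrite raises_rho ?mul0r // addn0 inordK.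
rewrite -coord_ord hy ?mulr0 //; last exact: ltnSE.
exact: leq_ltn_trans jt ti.
Qed.

Definition gfilt i : submodClosed gmod := prop_submod (vanish_closed i).

Lemma gfiltP i y : reflect (vanish i y) (y \in gfilt i).
Proof. exact: prop_submodP. Qed.

Lemma gfilt_le i j : (i <= j)%N -> {subset gfilt j <= gfilt i}.
Proof.
by move=> ij y /gfiltP hy; apply/gfiltP => t ti; apply: hy; exact: leq_trans ti ij.
Qed.

Lemma gfilt0 y : y \in gfilt 0. Proof. exact/gfiltP. Qed.

Lemma gfilt_last y : y \in gfilt L.+1 -> y = 0.
Proof. by move=> /gfiltP h; apply: coordP => t tL; rewrite coord0; exact: h. Qed.

Lemma gbase_filt t : (t <= L)%N -> gbase t \in gfilt t.
Proof.
move=> tL; apply/gfiltP => u ut uL; by rewrite coord_base // ltn_eqF.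
Qed.

Lemma gfilt_step i y z : (i <= L)%N -> y \in gfilt i -> coord y i != 0 ->
  z \in gfilt i -> z - sc (coord z i / coord y i) *: y \in gfilt i.+1.
Proof.
move=> iL /gfiltP hy yi /gfiltP hz; apply/gfiltP => t; rewrite ltnS leq_eqVlt.
rewrite coordB coord_sc => /orP[/eqP->|ti] tL; last first.
  by rewrite (hy t ti tL) (hz t ti tL) mulr0 subr0.
by rewrite divfK // subrr.
Qed.

(* The successive arrows of the mast move the leading coefficient of y down to
   the last position, so that y generates all that lies below it. *)
Lemma gfilt_sub (N : submodClosed gmod) i y : (i <= L)%N -> y \in N ->
  y \in gfilt i -> coord y i != 0 -> {subset gfilt i <= N}.
Proof.
move: {2}(L - i)%N (erefl (L - i)%N) => k; elim: k i y => [|k IH] i y ki iL Ny hy yi z hz.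
  have {ki iL} iL : i = L by apply/eqP; rewrite eqn_leq iL -subn_eq0 ki.
  subst i; have /gfilt_last/eqP := gfilt_step (leqnn L) hy yi hz.
  by rewrite subr_eq0 => /eqP->; exact: rpredZ.
have {}iL : (i < L)%N by rewrite -subn_gt0 ki.
have /gfiltP hy' := hy.
have yu u : (u < i)%N -> coord y u = 0.
  by move=> ui; apply: hy' => //; apply: leq_trans (ltnW ui) (ltnW iL).
set y' := pa (garrow n i) *: y.
have y't t : (t <= L)%N -> coord y' t = (t == i.+1)%:R * coord y i.
  by move=> tL; rewrite coord_pa.
rewrite -[z](subrK (sc (coord z i / coord y i) *: y)); apply: rpredD; last exact: rpredZ.
apply: (IH i.+1 y') (gfilt_step (ltnW iL) hy yi hz) => //.
- by rewrite subnS ki.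
- exact: rpredZ.
- by apply/gfiltP => t ti tL; rewrite y't // ltn_eqF ?mul0r.
- by rewrite y't // eqxx mul1r.
Qed.

Lemma gfilt_lead y : y != 0 ->
  exists i, [/\ (i <= L)%N, y \in gfilt i & coord y i != 0].
Proof.
move=> y0; have ex : exists t, (t <= L)%N && (coord y t != 0).
  apply: contrapT => nex; case/eqP: y0; apply: coordP => t tL; rewrite coord0.
  by apply/eqP; apply: contrapT => yt; apply: nex; exists t; rewrite tL; exact/negP.
case: (ex_minnP ex) => i /andP[iL yi] imin; exists i; split=> //.
apply/gfiltP => t ti tL; apply/eqP; apply: contraTT ti => yt.
by rewrite -leqNgt; apply: imin; rewrite tL.
Qed.

Lemma gfilt_line i : (i <= L)%N ->
  exists x, line (gvert n i : vertex Q) (x : subquot (gfilt i) (gfilt i.+1)).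
Proof.
move=> iL; have bi : coord (gbase i) i = 1 by rewrite coord_base ?eqxx.
apply: (subquot_line (x := gbase i)).
- exact: gbase_filt.
- by apply/negP => /gfiltP/(_ i (ltnSn i) iL)/eqP; rewrite bi oner_eq0.
- exact: gbase_pv.
move=> y hy; exists (coord y i / coord (gbase i) i).
by apply: gfilt_step => //; [exact: gbase_filt|rewrite bi oner_eq0].
Qed.

(** By [gfilt_sub], a submodule contains everything from the leading position of any of its elements
    on. So of an element of N outside M and one of M, the latter cannot lead first. *)
Lemma gmod_chain (N M : submodClosed gmod) : {subset N <= M} \/ {subset M <= N}.
Proof.
have [?|NM] := pselect {subset N <= M}; [by left|right=> z Mz].
have [y [Ny My]] : exists y, y \in N /\ y \notin M.
  apply: contrapT => h; apply: NM => y Ny; apply: contrapT => /negP My.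
  by apply: h; exists y.
have [->|z0] := eqVneq z 0; first exact: rpred0.
have [j [jL zj zj0]] := gfilt_lead z0.
have y0 : y != 0 by apply: contraNneq My => ->; exact: rpred0.
have [i [iL yi yi0]] := gfilt_lead y0.
have [ij|ji] := leqP i j.
  by apply: (gfilt_sub iL Ny yi yi0); exact: gfilt_le ij _ zj.
case/negP: My; apply: (gfilt_sub jL Mz zj zj0); exact: gfilt_le (ltnW ji) _ yi.
Qed.

Lemma gmod_uniserial : uniserial gmod.
Proof.
split; last exact: gmod_chain.
exists [:: gbase 0] => y; rewrite mem_fullm.
apply: (@gfilt_sub _ 0 (gbase 0)) (gfilt0 y) => //; last first.
- by rewrite coord_base ?eqxx ?oner_eq0.
- exact: gfilt0.
by apply: mem_span => /=; rewrite mem_seq1.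
Qed.

Lemma gmod_length : has_length gmod L.+1.
Proof.
exists (fun i => gfilt (L.+1 - i)); split=> [y|y|i iL].
- rewrite subn0 mem_zerom; apply/idP/eqP => [/gfilt_last//|->]; exact: rpred0.
- by rewrite subnn gfilt0 mem_fullm.
rewrite subSS subSn ?(ltnSE iL) //; split; first exact: gfilt_le.
by have [x /line_simple] := gfilt_line (leq_subr i L).
Qed.

Lemma gmod_radm1 : {subset radm gmod 1 <= gfilt 1}.
Proof.
apply: radm_ind; first exact: lin_closed_mem.
move=> a y Ja _; have [x /line_simple simS] := gfilt_line (leq0n L).
exact: jacobson_subquot simS Ja (gfilt0 y).
Qed.

Lemma gmod_ini j : (j <= L)%N -> pcls I (ini p j) *: gbase 0 = gbase j.
Proof.
elim: j => [|j IH] jL.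
  rewrite [RHS]gbase_pv //; congr (pcls I _ *: _).
  by apply: qpath_eq; rewrite // /parrows /= take0.
have -> : pcls I (ini p j.+1) = pa (garrow n j) * pcls I (ini p j).
  by rewrite pclsM ini_gmastS.
rewrite -scalerA IH 1?ltnW //; apply: coordP => t tL.
rewrite coord_pa // => [|u uj]; rewrite !coord_base ?eqxx ?mulr1 //; try exact: ltnW.
  by rewrite ltn_eqF.
by apply: leq_trans (ltnW uj) (ltnW jL).
Qed.

Lemma gmod_mast : has_mast gmod p.
Proof.
split; [exact: gmod_uniserial|by rewrite plen_gmast; exact: gmod_length|].
exists (gbase 0); have -> : p = ini p L.
  by apply: qpath_eq; rewrite // [RHS](_ : _ = take L (parrows p)) // -plen_gmast take_size.
rewrite gmod_ini // => /(congr1 (coord^~ L)) /eqP.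
by rewrite coord_base // eqxx coord0 oner_eq0.
Qed.

Lemma gmod_top : gbase 0 \notin radm gmod 1.
Proof.
apply/negP => /gmod_radm1/gfiltP/(_ 0%N isT (leq0n L))/eqP.
by rewrite coord_base // oner_eq0.
Qed.

Lemma gmod_skip (i : 'I_n.+1) :
  pa (garrow n (3 * i).+2) *: gbase (3 * i).+1 = sc (kappa i) *: gbase (3 * i).+3.
Proof.
have iL : ((3 * i).+2 < L)%N by rewrite glenE; have := ltn_ord i; lia.
rewrite [LHS]repmod_bcls rho_apath [RHS]repmod_sc.
have := garr_unit kappa iL (ltnW (ltnW iL)).
rewrite gcoef_skip inord_val => /(congr1 (mulmx^~ (delta_mx 0 0 : 'cV_L.+1))).
by rewrite -mulmxA -scalemxAl !mul_delta_mx.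
Qed.

End GadgetModule.

(** * Detours on the mast correspond to gadgets *)

Section GadgetDetours.
Variable n : nat.
Local Notation Q := (gquiver n).
Local Notation L := (glen n).
Local Notation p := (gmast n).
Local Open Scope nat_scope.

Lemma gdetour_indexP (d : detour_index p) :
  [/\ dtr_len d %% 3 = 1, dtr_len d < L, dtr_arrow d = garrow n (dtr_len d).+1
    & (val d).2 = (dtr_len d).+2 :> nat].
Proof.
rewrite /dtr_len /dtr_arrow; case/and3P: (valP d) => h1 h2 /eqP h3.
have le (j : 'I_(plen p).+1) : j <= L by rewrite -ltnS -plen_gmast.
by have := gmast_detour (le _) (le _) h1 h2 h3.
Qed.

Lemma gdetour_index_inj (d d' : detour_index p) : dtr_len d = dtr_len d' -> d = d'.
Proof.
move=> dd; have [_ _ a b] := gdetour_indexP d; have [_ _ a' b'] := gdetour_indexP d'.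
apply: val_inj; move: dd a b a' b'; rewrite /dtr_len /dtr_arrow.
case: (val d) (val d') => [[a j] m] [[a' j'] m'] /= -> -> mm -> mm'.
by congr (_, _); apply: ord_inj; rewrite mm mm'.
Qed.

Lemma gdet_bounds (i : 'I_n.+1) :
  [/\ (3 * i).+1 < (plen p).+1, (3 * i).+3 < (plen p).+1, (3 * i).+3 <= L
    & (3 * i).+1 %% 3 = 1].
Proof. by rewrite plen_gmast glenE; have := ltn_ord i; split; lia. Qed.

Lemma gdet_subproof (i : 'I_n.+1) :
  let t := (garrow n (3 * i).+2, inord (3 * i).+1 : 'I_(plen p).+1,
            inord (3 * i).+3 : 'I_(plen p).+1) in
  [&& detour p t.1.1 (ini p t.1.2), t.1.2 < t.2 & pend (ini p t.2) == tgt t.1.1].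
Proof.
have [h1 h3 hL hm] := gdet_bounds i.
suff : [&& detour p (garrow n (3 * i).+2) (ini p (inord (3 * i).+1 : 'I_(plen p).+1)),
    (inord (3 * i).+1 : 'I_(plen p).+1) < (inord (3 * i).+3 : 'I_(plen p).+1) &
    pend (ini p (inord (3 * i).+3 : 'I_(plen p).+1)) == tgt (garrow n (3 * i).+2)] by [].
rewrite !inordK // ltnW // andTb; apply/andP; split; first exact: gmast_detourP (ltnW hL) hm.
by apply/eqP/(etrans (pend_ini_gmast hL))/esym/tgt_garrow.
Qed.

Definition gdet (i : 'I_n.+1) : detour_index p := exist _ (_, _, _) (gdet_subproof i).

Lemma dtr_len_gdet i : dtr_len (gdet i) = (3 * i).+1 :> nat.
Proof. by rewrite /dtr_len /= inordK //; have [] := gdet_bounds i. Qed.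

Lemma gdetK i : inord (dtr_len (gdet i) %/ 3) = i.
Proof.
rewrite dtr_len_gdet (_ : (3 * i).+1 %/ 3 = i) ?inord_val //; lia.
Qed.

Lemma gdet_of (d : detour_index p) : gdet (inord (dtr_len d %/ 3)) = d.
Proof.
apply: gdetour_index_inj; apply: ord_inj; rewrite dtr_len_gdet.
have [h1 h2 _ _] := gdetour_indexP d; rewrite glenE in h2; rewrite inordK; lia.
Qed.

Lemma gskip_index j : j < L -> j %% 3 = 1 -> exists i : 'I_n.+1, j = (3 * i).+1.
Proof.
rewrite glenE => jL j1; have h : j %/ 3 < n.+1 by lia.
by exists (Ordinal h); rewrite /=; lia.
Qed.

Variable K : fieldType.

(** With its inverse [ungk], the renaming of coordinates along the bijection [gdet] from gadgets to
    detour triples. *)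
Definition gk (kappa : {ffun 'I_n.+1 -> K}) : {ffun detour_index p -> K} :=
  [ffun d => kappa (inord (dtr_len d %/ 3))].
Definition ungk (k : {ffun detour_index p -> K}) : {ffun 'I_n.+1 -> K} :=
  [ffun i => k (gdet i)].

Lemma gkK : cancel gk ungk.
Proof. by move=> kappa; apply/ffunP => i; rewrite !ffunE gdetK. Qed.
Lemma ungkK : cancel ungk gk.
Proof. by move=> k; apply/ffunP => d; rewrite !ffunE gdet_of. Qed.

End GadgetDetours.

(** * Uniserial modules in the basis of right subpaths *)

Section GadgetMast.
Variables (K : fieldType) (n : nat).
Local Notation Q := (gquiver n).
Variable I : twoSidedIdeal (path_algebra K Q).
Hypothesis admI : admissible I.
Local Notation L := (glen n).
Local Notation Lambda := (bound_algebra I).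
Local Notation pv e := (pcls I (@vpath Q e)).
Local Notation pa a := (pcls I (apath a)).
Local Notation sc := (sc I).
Local Notation p := (gmast n).
Implicit Types (kappa : {ffun 'I_n.+1 -> K}).

(** The full module structure in the basis of right subpaths, with the coefficients of [grep kappa];
    the detour relations prescribe only part of it. *)
Definition gaction kappa (U : lmodType Lambda) (x : U) :=
  forall s t, (s < L)%N -> (t <= L)%N ->
    pa (garrow n s) *: mvec p x t = sc (gcoef kappa s t) *: mvec p x s.+1.

Section OneModule.
Variables (U : lmodType Lambda) (x : U) (e : vertex Q).
Hypothesis mastU : has_mast U p.
Hypothesis topx : x \notin radm U 1.
Hypothesis xe : x = pv e *: x.
Local Notation u := (mvec p x).

Lemma gmast_start : e = gvert n 0.
Proof. exact: (mast_start admI mastU topx xe). Qed.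

Lemma u_vert t : (t <= L)%N -> u t = pv (gvert n t) *: u t.
Proof. by move=> tL; rewrite {1}mvec_pend pend_ini_gmast. Qed.

Lemma u_step t : (t < L)%N -> pa (garrow n t) *: u t = u t.+1.
Proof. by move=> tL; rewrite /mvec scalerA pclsM ini_gmastS. Qed.

Lemma mem_u t : (t <= L)%N -> u t \in radm U t.
Proof. by move=> tL; apply: (mem_mvec admI); rewrite plen_gmast. Qed.

Lemma u_neq0 t : (t <= L)%N -> u t != 0.
Proof.
move=> tL; have tp : (t <= plen p)%N by rewrite plen_gmast.
by apply: contraNneq (notin_mvec admI mastU topx xe tp) => ->; exact: rpred0.
Qed.

Lemma pa_radm s t : (t <= L)%N -> pa (garrow n s) *: u t \in radm U t.+1.
Proof. by move=> tL; apply: mem_radm (jacobson_pa admI _) (mem_u tL). Qed.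

Lemma vert_unique i j0 y e' : y \in radm U i -> (i <= j0)%N -> (j0 <= L)%N ->
  y = pv e' *: y ->
  (forall j, (i <= j)%N -> (j <= L)%N -> gvert n j = e' -> j = j0) ->
  exists c, y = sc c *: u j0.
Proof.
move=> hy ij jL ye h.
have il : (i <= (plen p).+1)%N by rewrite plen_gmast ltnW // ltnS (leq_trans ij).
have [c ->] := mast_expand_pv admI mastU topx xe hy il ye.
rewrite plen_gmast big_mkcond (bigD1_seq j0) ?iota_uniq ?mem_index_iota ?ij ?ltnS //=.
rewrite big1_seq ?addr0 => [|j /andP[jj]]; last first.
  rewrite mem_index_iota ltnS => /andP[ij' jL']; case: eqP => //.
  by rewrite pend_ini_gmast // => /(h _ ij' jL')/eqP; rewrite (negPf jj).
by case: ifP => _; [exists (c j0)|exists 0; rewrite sc0 scale0r].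
Qed.

Lemma vert_zero i y e' : y \in radm U i -> (i <= L.+1)%N -> y = pv e' *: y ->
  (forall j, (i <= j)%N -> (j <= L)%N -> gvert n j <> e') -> y = 0.
Proof.
move=> hy iL ye h; have il : (i <= (plen p).+1)%N by rewrite plen_gmast.
have [c ->] := mast_expand_pv admI mastU topx xe hy il ye.
rewrite plen_gmast big_nat_cond big1 // => j /andP[/andP[ij jL] /eqP].
by rewrite pend_ini_gmast // => /h; case.
Qed.

Lemma pa_vert s (y : U) : (s < L)%N ->
  pa (garrow n s) *: y = pv (gvert n s.+1) *: (pa (garrow n s) *: y).
Proof. by move=> sL; rewrite -(tgt_garrow sL) scalerA pa_tgt. Qed.

(** The exit lands in J^(3i+2) U at the vertex of position 3 * i + 3, which no other position
    shares. *)
Lemma skip_exists (i : 'I_n.+1) : exists c,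
  pa (garrow n (3 * i).+2) *: u (3 * i).+1 = sc c *: u (3 * i).+3.
Proof.
have [_ _ iL _] := gdet_bounds i.
apply: (vert_unique (pa_radm _ (ltnW (ltnW iL))) (leqnSn _) iL (pa_vert _ iL)).
by move=> j ij jL /(gvert_eq jL iL); rewrite /gpos; lia.
Qed.

Lemma gaction_exists : exists kappa, gaction kappa x.
Proof.
pose c i := sval (cid (skip_exists i)).
have hc i : _ = sc (c i) *: _ := svalP (cid (skip_exists i)).
exists [ffun i => c i] => s t sL tL.
have [->|ts] := eqVneq t s; first by rewrite gcoef_diag sc1 scale1r u_step.
have [/andP[/eqP s2 /eqP st]|ns] := boolP ((s %% 3 == 2) && (t.+1 == s))%N.
  have i1 : (s %/ 3 < n.+1)%N by rewrite glenE in sL; lia.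
  pose i := Ordinal i1.
  have -> : s = (3 * i).+2 by rewrite /=; lia.
  have -> : t = (3 * i).+1 by rewrite /=; lia.
  by rewrite gcoef_skip ffunE inord_val hc.
rewrite [gcoef _ _ _](_ : _ = 0) ?sc0 ?scale0r; last first.
  by rewrite /gcoef (negPf ts) (negPf ns) add0r mul0r.
have [sv|sv] := eqVneq (gvert n s) (gvert n t); last first.
  rewrite -(pa_src I) -scalerA (pv_scaler _ (u_vert tL)) src_garrow //.
  by rewrite (negPf sv) scaler0.
(* What remains is a second run through a loop, s = 3i + 1 and t = 3i + 2: it lands in J^(t+1) U at
   a vertex that no position after t has. *)
apply: (vert_zero (pa_radm s tL) tL (pa_vert _ sL)) => j tj jL /(gvert_eq jL sL).
move: (gvert_eq (ltnW sL) tL sv) ts ns tj; rewrite /gpos.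
move=> h /eqP ts ns tj hj; have [s2|] := boolP (s %% 3 == 2)%N; last by lia.
have [st|] := boolP (t.+1 == s)%N; last by lia.
by rewrite s2 st in ns.
Qed.

Lemma gaction_skip kappa (i : 'I_n.+1) : gaction kappa x ->
  pa (garrow n (3 * i).+2) *: u (3 * i).+1 = sc (kappa i) *: u (3 * i).+3.
Proof.
move=> h; have [_ _ iL _] := gdet_bounds i.
by rewrite h ?gcoef_skip ?inord_val //; exact: (ltnW (ltnW iL)).
Qed.

Lemma gaction_path kappa A : gaction kappa x ->
  pcls I (gpath n (gskip A)) *: x = sc (gmono kappa A) *: u L.
Proof.
move=> h; have x0 : u 0 = x by exact: (mvec0 admI mastU topx xe).
have -> : pcls I (gpath n (gskip A)) *: x =
    (\prod_(t <- rev (gword (gskip A) n.+1)) pa (garrow n t)) *: u 0.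
  rewrite pcls_word -scalerA [parrows _](_ : _ = map (garrow n) (gword (gskip A) n.+1)) //.
  by rewrite -map_rev big_map x0 [X in _ *: X](_ : _ = x) // [RHS]xe gmast_start.
have := @gword_eval _ U (fun t => pa (garrow n t)) (fun j => sc (kappa (inord j))) u _
  (gskip A) n.+1.
rewrite -glenE => E; apply: etrans (E _ _ _) _ => {E} [j t|t tL|j jn|].
- by rewrite /GRing.comm scC.
- exact: u_step.
- by have := gaction_skip (inord j) h; rewrite inordK.
congr (_ *: _); rewrite -gmonoE (big_morph sc (@scM _ _ _) (sc1 _)).
by apply: eq_bigr => j _; case: ifP => // _; rewrite sc1.
Qed.

Lemma detour_sum (k : {ffun detour_index p -> K}) (i : 'I_n.+1) (j : 'I_(plen p).+1) :
  j = (3 * i).+1 :> nat ->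
  \sum_(d : detour_index p | (dtr_arrow d == garrow n (3 * i).+2) && (dtr_len d == j))
      (k d *: pcls I (dtr_v d)) *: x = sc (k (gdet i)) *: u (3 * i).+3.
Proof.
move=> ji; rewrite (big_pred1 (gdet i)) => [|d].
  rewrite sc_mull -scalerA; congr (sc _ *: (pcls I (ini p _) *: x)).
  by have [_ _ _ ->] := gdetour_indexP (gdet i); rewrite dtr_len_gdet.
have lj : dtr_len (gdet i) = j by apply: ord_inj; rewrite dtr_len_gdet ji.
apply/andP/eqP => [[_ /eqP dj]|->].
  by apply: gdetour_index_inj; rewrite dj lj.
by have [_ _ -> _] := gdetour_indexP (gdet i); rewrite lj ji !eqxx.
Qed.

Lemma gaction_relations kappa : gaction kappa x ->
  forall (a : arrow Q) (j : 'I_(plen p).+1), detour p a (ini p j) ->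
    pa a *: (pcls I (ini p j) *: x) =
    \sum_(d : detour_index p | (dtr_arrow d == a) && (dtr_len d == j))
      (gk kappa d *: pcls I (dtr_v d)) *: x.
Proof.
move=> h a j dj; have le (m : 'I_(plen p).+1) : (m <= L)%N by rewrite -ltnS -plen_gmast.
have /and3P[_ _ /existsP[m /andP[]]] := dj.
rewrite plen_ini => jm /eqP ma.
have [j1 jL -> mj] := gmast_detour (le _) (le _) dj jm ma.
have [i ji] := gskip_index jL j1.
by rewrite ji (detour_sum _ ji) ffunE gdetK -gaction_skip.
Qed.

(** Some [kappa] describes the action; at each gadget its value and that of [k] multiply the same
    nonzero basis vector to the same result. *)
Lemma relations_gaction (k : {ffun detour_index p -> K}) :
  (forall (a : arrow Q) (j : 'I_(plen p).+1), detour p a (ini p j) ->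
    pa a *: (pcls I (ini p j) *: x) =
    \sum_(d : detour_index p | (dtr_arrow d == a) && (dtr_len d == j))
      (k d *: pcls I (dtr_v d)) *: x) -> gaction (ungk k) x.
Proof.
move=> h; have [kappa hk] := gaction_exists; suff -> : ungk k = kappa by [].
apply/ffunP => i; have [h1 _ iL h3] := gdet_bounds i.
have ji : (inord (3 * i).+1 : 'I_(plen p).+1) = (3 * i).+1 :> nat by rewrite inordK.
have := h (garrow n (3 * i).+2) (inord (3 * i).+1); rewrite (detour_sum _ ji) ji.
move=> /(_ (gmast_detourP (ltnW iL) h3)).
rewrite -/(u (3 * i).+1) (gaction_skip _ hk) ffunE => E.
exact/esym/(sc_scaler_inj (u_neq0 iL) E).
Qed.

Lemma gaction_realizes kappa : gaction kappa x -> realizes (gk kappa) U.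
Proof.
move=> h; split=> //; exists x; first by split=> //; exists e.
exact: gaction_relations.
Qed.

End OneModule.

Section TwoModules.
Variables (U U' : lmodType Lambda) (x : U) (x' : U') (e e' : vertex Q).
Variable kappa : {ffun 'I_n.+1 -> K}.
Hypotheses (mastU : has_mast U p) (mastU' : has_mast U' p).
Hypotheses (topx : x \notin radm U 1) (topx' : x' \notin radm U' 1).
Hypotheses (xe : x = pv e *: x) (xe' : x' = pv e' *: x').
Hypotheses (actx : gaction kappa x) (actx' : gaction kappa x').
Local Notation comb c y := (\sum_(0 <= t < L.+1) sc (c t) *: mvec p y t).

(** The graph of the map carrying one basis of right subpaths to the other. As a relation it can be
    shown to respect the action without uniqueness of coefficients, which only [matched_fun] brings
    in. *)
Definition matched y y' := exists c : nat -> K, y = comb c x /\ y' = comb c x'.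

Lemma matched_lin a y y' z z' : matched y y' -> matched z z' ->
  matched (sc a *: y + z) (sc a *: y' + z').
Proof.
move=> [c [-> ->]] [d [-> ->]]; exists (fun t => a * c t + d t).
have h (V : lmodType Lambda) (v : V) :
    sc a *: comb c v + comb d v = comb (fun t => a * c t + d t) v.
  rewrite scaler_sumr -big_split; apply: eq_bigr => t _ /=.
  by rewrite scD scM scalerDl scalerA.
by rewrite !h.
Qed.

Lemma matched0 : matched 0 0.
Proof. by exists (fun=> 0); split; rewrite big1 // => t _; rewrite sc0 scale0r. Qed.

Lemma matched_pa a y y' : matched y y' -> matched (pa a *: y) (pa a *: y').
Proof.
rewrite -(garrow_val a); have aL := ltn_ord a; move: (nat_of_ord a) aL => s sL [c [-> ->]].
exists (fun t => (t == s.+1)%:R * \sum_(0 <= i < L.+1) c i * gcoef kappa s i).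
have h (V : lmodType Lambda) (v : V) : gaction kappa v -> pa (garrow n s) *: comb c v =
    comb (fun t => (t == s.+1)%:R * \sum_(0 <= i < L.+1) c i * gcoef kappa s i) v.
  move=> hv; rewrite scaler_sumr [RHS](bigD1_seq s.+1) ?iota_uniq ?mem_index_iota //=.
  rewrite eqxx mul1r [X in _ + X]big1 ?addr0 => [|t /negPf->]; last first.
    by rewrite mul0r sc0 scale0r.
  rewrite sc_sum scaler_suml; apply: eq_big_nat => t /andP[_ tL].
  by rewrite sc_scalerC hv // scalerA -scM.
by rewrite !h.
Qed.

Lemma matched_pv v y y' : matched y y' -> matched (pv v *: y) (pv v *: y').
Proof.
move=> [c [-> ->]]; exists (fun t => (v == gvert n t)%:R * c t).
have h (V : lmodType Lambda) (z : V) :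
    pv v *: comb c z = comb (fun t => (v == gvert n t)%:R * c t) z.
  rewrite scaler_sumr; apply: eq_big_nat => t /andP[_ tL].
  rewrite sc_scalerC (pv_scaler _ (u_vert _ tL)).
  by case: eqP; rewrite ?mul1r // mul0r sc0 scale0r scaler0.
by rewrite !h.
Qed.

Lemma matched_scaler r y y' : matched y y' -> matched (r *: y) (r *: y').
Proof.
elim/bound_algebra_ind: r y y' => [|a r r' hr hr'|q] y y' yy'.
- by rewrite !scale0r; exact: matched0.
- rewrite sc_mull !scalerDl -!scalerA; apply: matched_lin; [exact: hr|exact: hr'].
rewrite pcls_word -!scalerA; have := matched_pv (pstart q) yy'.
move: (_ *: y) (_ *: y') => {y y' yy'}; elim: (rev _) => [|a s IH] y y' yy'.
  by rewrite big_nil !scale1r.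
by rewrite big_cons -!scalerA; apply/matched_pa/IH.
Qed.

Lemma matched_total y : exists y', matched y y'.
Proof.
have [c h] := mast_expand admI mastU topx xe (i := 0) (y := y) isT (leq0n _).
rewrite plen_gmast in h; by exists (comb c x'), c.
Qed.

Lemma matched_fun y : matched 0 y -> y = 0.
Proof.
move=> [c [/esym h ->]]; rewrite big_nat_cond big1 // => t /andP[/andP[_ tL] _].
have := mast_free admI mastU topx xe (c := c); rewrite plen_gmast => ->//.
by rewrite sc0 scale0r.
Qed.

End TwoModules.

Lemma matched_sym (U U' : lmodType Lambda) (x : U) (x' : U') y y' :
  matched x x' y y' -> matched x' x y' y.
Proof. by move=> [c [? ?]]; exists c. Qed.

Lemma gmast_iso (U U' : lmodType Lambda) (x : U) (x' : U') e e' kappa :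
  has_mast U p -> has_mast U' p -> x \notin radm U 1 -> x' \notin radm U' 1 ->
  x = pv e *: x -> x' = pv e' *: x' -> gaction kappa x -> gaction kappa x' ->
  module_iso U U'.
Proof.
move=> mU mU' tx tx' xe xe' ax ax'.
pose f y := sval (cid (matched_total x' mU tx xe y)).
have hf y : matched x x' y (f y) := svalP (cid (matched_total x' mU tx xe y)).
pose g y := sval (cid (matched_total x mU' tx' xe' y)).
have hg y : matched x' x y (g y) := svalP (cid (matched_total x mU' tx' xe' y)).
have uniq (V V' : lmodType Lambda) (v : V) (v' : V') w :
    has_mast V p -> v \notin radm V 1 -> v = pv w *: v ->
    forall y z z', matched v v' y z -> matched v v' y z' -> z = z'.
  move=> mV tv vw y z z' yz yz'; apply/eqP; rewrite -subr_eq0; apply/eqP.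
  apply: (matched_fun mV tv vw (x' := v')).
  by have := matched_lin (-1) yz' yz; rewrite scN sc1 !scaleN1r addNr addrC.
have linf : linear f.
  move=> r y z; apply: (uniq _ _ _ _ _ mU tx xe _ _ _ (hf _)).
  have := matched_lin 1 (matched_scaler ax ax' r (hf y)) (hf z).
  by rewrite sc1 !scale1r.
pose h := GRing.isLinear.Build Lambda U U' *:%R f linf.
exists (HB.pack_for {linear U -> U'} f h), g => y /=.
  by apply: (uniq _ _ _ _ _ mU' tx' xe' _ _ _ (hg _)); exact/matched_sym/hf.
by apply: (uniq _ _ _ _ _ mU tx xe _ _ _ (hf _)); exact/matched_sym/hg.
Qed.

End GadgetMast.

Section PathsThrough.
Variable n : nat.
Local Notation Q := (gquiver n).
Local Notation L := (glen n).
Local Notation p := (gmast n).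

Definition gseq (i : 'I_(plen p).+1) : vertex Q := gvert n i.

Lemma chain_src (Q' : quiver) (v : vertex Q') s a j : chain v s -> (j < size s)%N ->
  src (nth a s j) = nth v (v :: map tgt s) j.
Proof.
elim: s v j => //= b s IH v [|j] /andP[/eqP bv cs] js //=.
rewrite (IH _ _ cs js); apply: set_nth_default.
by rewrite /= size_map ltnW.
Qed.

Lemma codom_gseq v j : (j <= L)%N -> nth v (codom gseq) j = gvert n j.
Proof.
move=> jL; have jp : (j < (plen p).+1)%N by rewrite plen_gmast.
rewrite codomE (nth_map (Ordinal jp)) ?size_enum_ord // /gseq.
by congr gvert; rewrite nth_enum_ord.
Qed.

(** An arrow between two successive positions of the mast is determined by its ends, so the vertices
    determine the path. *)
Lemma passes_gseq q : passes_through gseq q <-> q = p.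
Proof.
have sc : size (codom gseq) = L.+1 by rewrite size_codom card_ord plen_gmast.
rewrite /passes_through; split=> [/eqP h|->]; last first.
  have sp : size (pstart p :: map tgt (parrows p)) = L.+1.
    by rewrite /= size_map -[size _]/(plen p) plen_gmast.
  apply/eqP/(@eq_from_nth _ (gvert n 0 : vertex Q)) => [|j]; rewrite sp ?sc // ltnS => jL.
  rewrite codom_gseq //; case: j jL => [//|j] jL.
  have jp : (j < size (parrows p))%N by rewrite [size _]plen_gmast.
  rewrite -[LHS]/(nth _ (map tgt (parrows p)) j) (nth_map (garrow n 0)) //.
  by rewrite gmast_nth // tgt_garrow.
have sq : size (parrows q) = L by have := congr1 size h; rewrite sc /= size_map => -[].
have nq j : (j <= L)%N -> nth (pstart q) (pstart q :: map tgt (parrows q)) j = gvert n j.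
  by move=> jL; rewrite h codom_gseq.
apply: qpath_eq; first exact: (nq 0%N).
apply: (@eq_from_nth _ (garrow n 0)); first by rewrite sq -[RHS]/(plen p) plen_gmast.
move=> j; rewrite sq => jL; rewrite gmast_nth //; apply: gmast_step => //.
  rewrite (chain_src _ (pdataP q)) -?/(parrows q) ?sq //; exact: nq (ltnW jL).
by have := nq j.+1 jL; rewrite /= (nth_map (garrow n 0)) ?sq.
Qed.

Lemma path_through_gseq : path_through gseq = Some p.
Proof.
rewrite /path_through; case: pselect => [h|h]; last by case: h; exists p; apply/passes_gseq.
by congr Some; apply/passes_gseq; exact: xchooseP.
Qed.

End PathsThrough.

(** * The variety and the map Phi for the gadget algebra *)

Section GadgetTheorem.
Variables (K : fieldType) (n : nat) (W : set {ffun 'I_n.+1 -> K}).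
Local Notation Q := (gquiver n).
Local Notation I := (gideal W).
Local Notation admI := (gideal_admissible W).
Local Notation L := (glen n).
Local Notation Lambda := (bound_algebra I).
Local Notation pv e := (pcls I (@vpath Q e)).
Local Notation pa a := (pcls I (apath a)).
Local Notation sc := (sc I).
Local Notation p := (gmast n).

Definition gsimple (i : 'I_(plen p).+1) : lmodType Lambda := vertex_simple I (gseq i).

Lemma gsimple_sequence : simple_sequence gsimple (@gseq n).
Proof.
move=> i; split; last exact: module_iso_refl.
by have [x /line_simple] := vertex_simple_line admI (gseq i).
Qed.

Lemma realizes_top (k : {ffun detour_index p -> K}) (U : lmodType Lambda) :
  realizes k U -> exists (x : U) e,
  [/\ has_mast U p, x \notin radm U 1, x = pv e *: x & gaction (ungk k) x].
Proof.
move=> [mU [x [tx [e xe]] h]]; exists x, e; split=> //.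
exact: (relations_gaction admI mU tx xe).
Qed.

Lemma realizes_iso (k : {ffun detour_index p -> K}) (U U' : lmodType Lambda) :
  realizes k U -> realizes k U' -> module_iso U U'.
Proof.
move=> /realizes_top[x [e [mU tx xe ax]]] /realizes_top[x' [e' [mU' tx' xe' ax']]].
exact: (gmast_iso admI mU mU' tx tx' xe xe' ax ax').
Qed.

Lemma Phi_iso_class (k : {ffun detour_index p -> K}) (U : lmodType Lambda) :
  realizes k U -> Phi_path k = iso_class U.
Proof.
move=> kU; apply/funext => M; apply/propext; split=> [[U' kU' MU']|MU].
  exact: module_iso_trans MU' (realizes_iso kU' kU).
by exists U.
Qed.

Lemma realizes_series (k : {ffun detour_index p -> K}) (U : lmodType Lambda) :
  realizes k U -> has_series U gsimple.
Proof.
move=> kU; have [x [e [mU tx xe _]]] := realizes_top kU.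
case: (mU) => unU lU _; split=> // i.
have [y ly] := mast_line admI mU tx xe (ltnSE (ltn_ord i)).
have [z lz] := vertex_simple_line admI (gseq i).
apply: (line_iso admI ly (y := z)).
by rewrite pend_ini_gmast // -plen_gmast; exact: ltnSE.
Qed.

(** Surjectivity of Phi: the layers force the mast, and the module with this mast has coordinates by
    [gaction_exists]. *)
Lemma series_realizes (U : lmodType Lambda) : has_series U gsimple ->
  exists kappa, realizes (gk kappa) U.
Proof.
move=> [unU lU hS].
pose S i := vertex_simple I (pend (ini p i)).
pose s i : S i := sval (cid (vertex_simple_line admI (pend (ini p i)))).
have ls i : line (pend (ini p i)) (s i) :=
  svalP (cid (vertex_simple_line admI (pend (ini p i)))).
have isoS i : (i <= plen p)%N -> module_iso (subquot (radm U i) (radm U i.+1)) (S i).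
  move=> ip; have := hS (Ordinal (ip : (i < (plen p).+1)%N)).
  by rewrite /gsimple /gseq /S pend_ini_gmast // -plen_gmast.
have [|mU [x [tx xe]]] := series_mast admI unU lU ls isoS.
  move=> i a; rewrite plen_gmast => iL; rewrite !pend_ini_gmast ?(ltnW iL) // => sa ta.
  by rewrite (gmast_step iL sa ta) ini_gmastS.
have [kappa hk] := gaction_exists admI mU tx xe.
exists kappa; exact: (gaction_realizes mU tx xe hk).
Qed.

Lemma gmod_realizes kappa : W kappa -> V_path I (gk kappa).
Proof.
move=> Wk; exists (gmod Wk); have mU := gmod_mast Wk; have tx := gmod_top Wk.
have xe := gbase_pv Wk (leq0n L).
have [kappa' hk] := gaction_exists admI mU tx xe.
suff kk : kappa' = kappa.
  by have := gaction_realizes mU tx xe hk; rewrite [in gk _]kk.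
have u t : (t <= L)%N -> mvec p (gbase Wk 0) t = gbase Wk t by exact: gmod_ini.
apply/ffunP => i; have [_ _ iL _] := gdet_bounds i.
have := gaction_skip i hk; rewrite !u //; last exact: (ltnW (ltnW iL)).
rewrite gmod_skip -(u _ iL) => E; apply/esym; apply: sc_scaler_inj E.
exact: (u_neq0 admI mU tx xe).
Qed.

Hypothesis W_multilinear : forall kappa, ~ W kappa ->
  exists c : {set 'I_n.+1} -> K,
    (forall kappa', W kappa' -> \sum_A c A * gmono kappa' A = 0) /\
    \sum_A c A * gmono kappa A != 0.

(** For a module at a point outside [W], take a separating multilinear polynomial. Its relation is
    zero in the algebra, but acts on the top element as the nonzero value of the polynomial times
    the last basis vector. *)
Lemma V_path_gadget k : V_path I k <-> W (ungk k).
Proof.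
split=> [[U kU]|Wk]; last by rewrite -[k]ungkK; exact: gmod_realizes.
have [x [e [mU tx xe ax]]] := realizes_top kU.
apply: contrapT => /W_multilinear[c [/gideal_relation cW /negP]]; apply; apply/eqP.
apply: (sc_scaler_eq0 (x := mvec p x L)); last exact: (u_neq0 admI mU tx xe).
have z0 : bcls I (\sum_A c A *: pvec (gpath n (gskip A))) = 0.
  by rewrite -[RHS](raddf0 (bcls I)); apply/bcls_eq; rewrite subr0.
rewrite -[RHS](scale0r x) -z0 linear_sum sc_sum !scaler_suml; apply: eq_bigr => A _ /=.
have -> : bcls I (c A *: pvec (gpath n (gskip A))) = c A *: pcls I (gpath n (gskip A)).
  exact: bclsZ.
by rewrite sc_mull -scalerA (gaction_path admI mU tx xe A ax) scM [LHS]/= -[LHS]scalerA.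
Qed.

(** An isomorphism multiplies the whole basis of right subpaths by one nonzero scalar, which cancels
    from the detour relations. *)
Lemma Phi_path_inj (k k' : {ffun detour_index p -> K}) :
  V_path I k -> V_path I k' -> Phi_path k = Phi_path (I := I) k' -> k = k'.
Proof.
move=> [U kU] [U' kU'] E.
have : Phi_path (I := I) k U by exists U; [exact: kU|exact: module_iso_refl].
rewrite E (Phi_iso_class kU') => -[f [g fK gK]].
have [x [e [mU tx xe ax]]] := realizes_top kU.
have [x' [e' [mU' tx' xe' ax']]] := realizes_top kU'.
rewrite -[k]ungkK -[k']ungkK; congr gk.
have fZ r y : f (r *: y) = r *: f y by exact: linearZ.
have f0 y : f y = 0 -> y = 0 by move=> h; rewrite -[y]fK h -[0](linear0 f) fK.
have fv : f x = pv (gvert n 0) *: f x.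
  by rewrite -(gmast_start admI mU tx xe) -fZ -xe.
have [c fc] : exists c, f x = sc c *: x'.
  have x0 := mvec0 admI mU' tx' xe'; rewrite -x0.
  apply: (vert_unique admI mU' tx' xe' (i := 0) (y := f x) isT (leq0n _) (leq0n _) fv).
  by move=> j _ jL /(gvert_eq jL (leq0n _)); rewrite /gpos; lia.
have fu t : f (mvec p x t) = sc c *: mvec p x' t by rewrite fZ fc sc_scalerC.
apply/ffunP => i; have [_ _ iL _] := gdet_bounds i.
have c0 : c != 0.
  apply/eqP => c0; have /eqP := u_neq0 admI mU tx xe (leq0n L); apply.
  by apply: f0; rewrite fu c0 sc0 scale0r.
have := congr1 f (gaction_skip i ax).
rewrite [LHS]fZ [RHS]fZ !fu [LHS]sc_scalerC (gaction_skip i ax').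
rewrite [RHS]sc_scalerC => h; have {}h : sc (ungk k' i) *: mvec p x' (3 * i).+3 =
    sc (ungk k i) *: mvec p x' (3 * i).+3.
  by rewrite -[LHS](scVK _ c0) h scVK.
exact/esym/(sc_scaler_inj (u_neq0 admI mU' tx' xe' iL) h).
Qed.

Lemma Phi_path_bij :
  bijective_between (@V_path K Q I p) (uniserial_types gsimple) (@Phi_path K Q I p).
Proof.
split=> [k [U kU]||C [U hU ->]].
- by exists U; [exact: realizes_series kU|exact: Phi_iso_class].
- exact: Phi_path_inj.
have [kappa hk] := series_realizes hU; exists (gk kappa); first by exists U.
exact: Phi_iso_class.
Qed.

End GadgetTheorem.

(** * Multilinear equations of a variety *)

Section Dickson.
Variable n : nat.
Implicit Types (L : set 'X_{1..n}) (m : 'X_{1..n}).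

(* Outside finitely many slices of the last coordinate, a basis for the previous
   coordinates already works. *)
Lemma dickson_upto k L : exists s : seq 'X_{1..n},
  (forall m, m \in s -> L m) /\
  forall m, L m -> exists2 m', m' \in s & forall i : 'I_n, (i < k)%N -> (m' i <= m i)%N.
Proof.
elim: k L => [|k IH] L.
  have [[m Lm]|nL] := pselect (exists m, L m).
    exists [:: m]; split=> [m'|m' _]; first by rewrite mem_seq1 => /eqP->.
    by exists m; rewrite ?mem_seq1.
  by exists [::]; split=> // m Lm; case: nL; exists m.
have [kn|nk] := ltnP k n; last first.
  have [s [sL hs]] := IH L; exists s; split=> // m /hs[m' sm' h]; exists m' => // i _.
  by apply: h; exact: leq_trans (ltn_ord i) nk.
pose j := Ordinal kn.
have /choice[t ht] := fun v : nat => IH [set m | L m /\ m j = v].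
have [s [sL hs]] := IH L.
(* Where the exponent at [j] is at least [M], the divisor found in [s] is also below at [j]; the
   other monomials lie in the slices v < M. *)
pose M := \max_(m <- s) m j.
exists (s ++ flatten [seq t v | v <- iota 0 M]); split=> [m|m Lm].
  rewrite mem_cat => /orP[/sL//|/flatten_mapP[v _ tm]].
  by have [/(_ m tm)[]] := ht v.
have [Mm|mM] := leqP M (m j).
  have [m' sm' h] := hs m Lm; exists m'; first by rewrite mem_cat sm'.
  move=> i; rewrite ltnS leq_eqVlt => /orP[/eqP ik|]; last exact: h.
  have -> : i = j by exact: val_inj.
  by apply: leq_trans Mm; rewrite /M (big_rem m') //= leq_maxl.
have [/(_ _)h1 h2] := ht (m j); have [m' tm' h] := h2 m (conj Lm erefl).
exists m'.
  by rewrite mem_cat; apply/orP; right; apply/flatten_mapP; exists (m j); rewrite ?mem_iota.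
move=> i; rewrite ltnS leq_eqVlt => /orP[/eqP ik|]; last exact: h.
have -> : i = j by exact: val_inj.
by have [_ ->] := h1 m' tm'.
Qed.

Lemma dickson L : exists s : seq 'X_{1..n},
  (forall m, m \in s -> L m) /\ forall m, L m -> exists2 m', m' \in s & (m' <= m)%MM.
Proof.
have [s [sL hs]] := dickson_upto n L; exists s; split=> // m /hs[m' sm' h].
by exists m' => //; apply/mnm_lepP => i; exact: h.
Qed.

End Dickson.

Section BoundedDegree.
Import Order.TTheory.
Variables (K : fieldType) (n : nat).
Implicit Types (P : {mpoly K[n]}) (v : 'I_n -> K).

Definition vanishing (Z : set ('I_n -> K)) P := forall v, Z v -> P.@[v] = 0.

(* The witness bounds the sizes of a Groebner basis of the vanishing ideal. *)
Lemma vanishing_bounded (Z : set ('I_n -> K)) : exists D, forall v,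
  (forall P, (msize P <= D)%N -> vanishing Z P -> P.@[v] = 0) ->
  forall P, vanishing Z P -> P.@[v] = 0.
Proof.
have [s [sL hs]] := dickson [set m | exists P, [/\ vanishing Z P, P != 0 & mlead P = m]].
have /choice[b hb] : forall m : 'X_{1..n}, exists P, m \in s ->
    [/\ vanishing Z P, P != 0 & mlead P = m].
  by move=> m; have [/sL[P hP]|_] := boolP (m \in s); [exists P|exists 0].
exists (\max_(m <- s) msize (b m)) => v hv P.
have bv m : m \in s -> (b m).@[v] = 0.
  move=> sm; have [bZ _ _] := hb m sm; apply: hv => //.
  by rewrite (big_rem m) //= leq_maxl.
elim/mleadrect: P => P IH PZ; have [->|P0] := eqVneq P 0; first exact: meval0.
have [|m' sm' m'P] := hs (mlead P); first by exists P.
have [bZ b0 bm] := hb m' sm'.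
(* One division step: [q] loses the leading term of [P], and its value at [v] is unchanged as the
   basis element vanishes there. *)
set q := P - (mleadc P / mleadc (b m')) *: ('X_[(mlead P - m')%MM] * b m').
have Pq : P.@[v] = q.@[v].
  by rewrite /q mevalB mevalZ mevalM (bv _ sm') !mulr0 subr0.
have qZ : vanishing Z q.
  by move=> w Zw; rewrite mevalB mevalZ mevalM PZ // bZ // !mulr0 subr0.
rewrite Pq; have [->|q0] := eqVneq q 0; first exact: meval0.
apply: IH qZ.
have c0 : mleadc P / mleadc (b m') != 0 by rewrite mulf_neq0 ?invr_eq0 ?mleadc_eq0.
have X0 m : 'X_[m] != 0 :> {mpoly K[n]}.
  by apply/eqP => /(congr1 (mcoeff m))/eqP; rewrite mcoeffX eqxx mcoeff0 oner_eq0.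
set r := 'X_[(mlead P - m')%MM] * b m' in q Pq q0 *.
have lr : mlead r = mlead P.
  by rewrite /r mleadM ?X0 // mleadXm bm submK.
have cr : r@_(mlead P) = mleadc (b m').
  by rewrite -lr /r mleadM ?X0 // mleadcM mleadXm mcoeffX eqxx mul1r.
rewrite lt_neqAle; apply/andP; split; last first.
  by apply: le_trans (mleadB_le _ _) _; rewrite mleadZ // lr joinxx.
apply: contraNneq q0 => qP; rewrite -mleadc_eq0 qP mcoeffB mcoeffZ cr.
by rewrite divfK ?mleadc_eq0 // subrr.
Qed.

End BoundedDegree.

(** * Trading powers for copies of coordinates *)

Section Copies.
Variables (K : fieldType) (n D : nat).
Local Notation G := (n * D.+1)%N.
Implicit Types (x : {ffun 'I_n -> K}).

(* Gadget i carries a copy of the coordinate i %/ D.+1; the last gadget, which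
   only ensures that there is one, carries 0. *)
Definition ocoord x (q : nat) : K := if insub q is Some j then x j else 0.
Definition copies x : {ffun 'I_G.+1 -> K} := [ffun i : 'I_G.+1 => ocoord x (i %/ D.+1)].
(** Reads each coordinate off its first copy; with [D.+1] copies there is one even for D = 0. *)
Definition uncopies (kappa : {ffun 'I_G.+1 -> K}) : {ffun 'I_n -> K} :=
  [ffun j : 'I_n => kappa (inord (j * D.+1))].

Lemma ocoord_ord x (j : 'I_n) : ocoord x j = x j.
Proof. by rewrite /ocoord valK. Qed.

Lemma first_copy (j : 'I_n) : (inord (j * D.+1) : 'I_G.+1) = (j * D.+1)%N :> nat.
Proof. by rewrite inordK // ltnS leq_mul2r ltnW ?orbT. Qed.

Lemma copiesK : cancel copies uncopies.
Proof. by move=> x; apply/ffunP => j; rewrite !ffunE first_copy mulnK // ocoord_ord. Qed.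

Definition oexp (m : 'X_{1..#|'I_n|}) (q : nat) : nat :=
  if insub q is Some j then m (enum_rank (j : 'I_n)) else 0.

(** The first m_j copies of each coordinate j, so that the squarefree monomial over this set becomes
    the monomial [m] on [copies x]. *)
Definition gset (m : 'X_{1..#|'I_n|}) : {set 'I_G.+1} :=
  [set i : 'I_G.+1 | (i %% D.+1 < oexp m (i %/ D.+1))%N].

Lemma gmono_gset x (m : 'X_{1..#|'I_n|}) : (forall i, (m i <= D)%N) ->
  gmono (copies x) (gset m) = \prod_i x (enum_val i) ^+ m i.
Proof.
move=> mD; pose f t := if (t %% D.+1 < oexp m (t %/ D.+1))%N then ocoord x (t %/ D.+1) else 1.
have -> : gmono (copies x) (gset m) = \prod_(0 <= t < G.+1) f t.
  rewrite big_mkord /gmono big_mkcond; apply: eq_bigr => i _.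
  by rewrite inE ffunE.
(* The last gadget belongs to no coordinate; without it the product splits into blocks of length
   [D.+1]. *)
have fG : f G = 1 by rewrite /f mulnK // /oexp insubF ?ltnn.
rewrite big_nat_recr // fG /= mulr1 big_nat_mul big_mkord.
rewrite [RHS](reindex enum_rank); last first.
  by exists enum_val => i _; rewrite ?enum_rankK ?enum_valK.
apply: eq_bigr => j _; rewrite enum_rankK -{1}[(j * D.+1)%N]add0n big_addn mulSn addnK.
have fE r : (r < D.+1)%N -> f (r + j * D.+1)%N = if (r < m (enum_rank j))%N then x j else 1.
  move=> rD; rewrite /f addnC modnMDl modn_small // divnMDl // divn_small // addn0.
  by rewrite ocoord_ord /oexp valK.
rewrite (eq_big_nat _ _ (fun r h => fE r (andP h).2)).
rewrite (@big_cat_nat _ _ _ (m (enum_rank j))) //=; last exact: leqW.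
rewrite [X in _ * X]big_nat_cond [X in _ * X]big1 ?mulr1; last first.
  by move=> r /andP[/andP[mr _] _]; rewrite ltnNge mr.
rewrite (eq_big_nat _ _ (F2 := fun=> x j)) ?prodr_const_nat ?subn0 // => r /andP[_ ->] //.
Qed.

Lemma sum_delta (F : {set 'I_G.+1} -> K) B : \sum_A (A == B)%:R * F A = F B.
Proof.
rewrite (bigD1 B) //= eqxx mul1r big1 ?addr0 // => A /negPf->.
by rewrite mul0r.
Qed.

Lemma gmono1 kappa (i : 'I_G.+1) : gmono kappa [set i] = kappa i :> K.
Proof. exact: big_set1. Qed.

(** A point is outside the copy of V for one of two reasons. If it consists of equal copies of a
    point outside V, an equation of V of bounded size, rewritten by [gset], separates it. Otherwise
    some gadget differs from the first copy of its coordinate, or the last gadget is not 0, and a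
    linear form does. *)
Lemma copies_multilinear (V : set {ffun 'I_n -> K}) :
  (forall x, ~ V x -> exists P : {mpoly K[#|'I_n|]},
     [/\ (msize P <= D)%N, forall y, V y -> peval P y = 0 & peval P x != 0]) ->
  forall kappa, ~ (copies @` V) kappa -> exists c : {set 'I_G.+1} -> K,
    (forall kappa', (copies @` V) kappa' -> \sum_A c A * gmono kappa' A = 0) /\
    \sum_A c A * gmono kappa A != 0.
Proof.
move=> hV kappa nk; have [kx|kx] := eqVneq kappa (copies (uncopies kappa)).
  have /hV[P [PD PV Px]] : ~ V (uncopies kappa).
    by move=> Vx; apply: nk; exists (uncopies kappa).
  exists (fun A => \sum_(m <- msupp P) P@_m * (A == gset m)%:R).
  have hP x : \sum_A (\sum_(m <- msupp P) P@_m * (A == gset m)%:R) * gmono (copies x) A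
      = peval P x.
    under eq_bigr => A _ do rewrite mulr_suml.
    rewrite exchange_big /= /peval mevalE big_seq [RHS]big_seq; apply: eq_bigr => m mP.
    under eq_bigr => A _ do rewrite -mulrA.
    (* Each exponent is at most the degree, which is below the size of P, hence below [D]. *)
    rewrite -mulr_sumr sum_delta gmono_gset // => i.
    apply: leq_trans (ltnW (leq_trans (msize_mdeg_lt mP) PD)).
    by rewrite mdegE (bigD1 i) //= leq_addr.
  by split=> [_ [y Vy <-]|]; [rewrite hP PV|rewrite kx hP].
have [i ki] : exists i : 'I_G.+1, kappa i != copies (uncopies kappa) i.
  apply: contrapT => h; case/eqP: kx; apply/ffunP => i; apply/eqP.
  by apply: contrapT => hi; apply: h; exists i; exact/negP.
pose d (kappa' : {ffun 'I_G.+1 -> K}) : K := ocoord (uncopies kappa') (i %/ D.+1).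
have [c hc] : exists c, forall kappa', \sum_A c A * gmono kappa' A = kappa' i - d kappa'.
  rewrite /d /ocoord; case: insub => [j|].
    pose i' : 'I_G.+1 := inord (j * D.+1).
    exists (fun A => (A == [set i]%SET)%:R - (A == [set i']%SET)%:R) => kappa'.
    under eq_bigr => A _ do rewrite mulrBl.
    by rewrite sumrB !sum_delta !gmono1 ffunE.
  exists (fun A => (A == [set i]%SET)%:R) => kappa'.
  by rewrite sum_delta gmono1 subr0.
exists c; split=> [_ [x Vx <-]|]; rewrite hc /d ?copiesK ?ffunE ?subrr //.
by move: ki; rewrite ffunE subr_eq0.
Qed.

End Copies.

(** The defining equations vanish on V, so [vanishing_bounded] shows that a point killed by all
    vanishing polynomials of size at most D satisfies them. *)
Lemma closed_bounded (K : fieldType) n (V : set {ffun 'I_n -> K}) : zariski_closed V ->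
  exists D, forall x, ~ V x -> exists P : {mpoly K[#|'I_n|]},
    [/\ (msize P <= D)%N, forall y, V y -> peval P y = 0 & peval P x != 0].
Proof.
move=> [S ->]; pose pt (x : {ffun 'I_n -> K}) := fun i : 'I_#|'I_n| => x (enum_val i).
pose Z : set ('I_#|'I_n| -> K) :=
  [set v | exists2 y, (forall P, S P -> peval P y = 0) & v = pt y].
have [D hD] := vanishing_bounded Z; exists D => x nSx; apply: contrapT => h; apply: nSx => P SP.
apply: (hD (pt x)) => [R RD RZ|v [y Sy ->]]; last exact: Sy.
apply/eqP; apply: contrapT => /negP Rx; apply: h; exists R; split=> // y Sy.
by apply: RZ; exists y.
Qed.

(** The types involved depend on [o]; with [o] a variable, the equation can be substituted. *)
Lemma bijective_opt (K : fieldType) (Q : quiver) (I : twoSidedIdeal (path_algebra K Q))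
    (o : option (qpath Q)) p (P : (lmodType (bound_algebra I) -> Prop) -> Prop) :
  o = Some p -> bijective_between (@V_path K Q I p) P (@Phi_path K Q I p) ->
  bijective_between (@V_opt K Q I o) P (@Phi_opt K Q I o).
Proof. by move=> ->. Qed.

Theorem proposition3p7 (K : fieldType) (K_infinite : infinite_set [set: K])
    (n : nat) (V : set {ffun 'I_n -> K}) (V_closed : zariski_closed V) :
  exists (Q : quiver) (I : twoSidedIdeal (path_algebra K Q)),
  [/\ admissible I,
      condition_N I &
      exists (l : nat) (S : 'I_l.+1 -> lmodType (bound_algebra I))
             (e : 'I_l.+1 -> vertex Q),
      [/\ simple_sequence S e,
          variety_iso (V_seq I e) V &
          bijective_between (V_seq I e) (uniserial_types S) (Phi_seq I e)]].
Proof.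
have [D /copies_multilinear VD] := closed_bounded V_closed.
set N := (n * D.+1)%N in VD; pose W := @copies K n D @` V.
exists (gquiver N), (gideal W); split.
- exact: gideal_admissible.
- exact: gcondition_N.
exists (plen (gmast N)), (gsimple W), (@gseq N).
have hV := V_path_gadget VD; have hPhi := Phi_path_bij W.
split; first exact: gsimple_sequence.
  rewrite /V_seq; move: (path_through_gseq N); case: path_through => // _ [->].
  (* Both maps only select, repeat or pad coordinates, so their component polynomials are variables
     or 0. *)
  exists (fun k => uncopies (ungk k)), (fun x => gk (copies D x)); split.
  - exists (fun j : 'I_n => 'X_(enum_rank (gdet (inord (j * D.+1) : 'I_N.+1)))
        : {mpoly K[#|detour_index (gmast N)|]}) => k j.
    by rewrite /peval mevalXU enum_rankK !ffunE.
  - exists (fun d : detour_index (gmast N) => let i : 'I_N.+1 := inord (dtr_len d %/ 3) in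
      if insub (i %/ D.+1)%N is Some j then 'X_(enum_rank (j : 'I_n)) else 0
        : {mpoly K[#|'I_n|]}) => x d.
    rewrite !ffunE /ocoord /peval; case: insub => [j|]; last by rewrite meval0.
    by rewrite mevalXU enum_rankK.
  - by move=> k /hV [x Vx xk]; rewrite -xk copiesK; split=> //; rewrite xk ungkK.
  move=> x Vx; rewrite gkK copiesK; split=> //.
  by apply/hV; rewrite gkK; exists x.
exact: (bijective_opt (path_through_gseq N) hPhi).
Qed.
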